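(* Let $d$ be even and let $C\subset A$ be a curve obtained by the construction described in the context, from an abelian surface $A$ with polarizing line bundle $L$ of type $(1,d)$ and a subgroup $X\le K(L)$ of order $d$, so that $C$ is an $X$-covering of a smooth genus $2$ curve. Then there is an $x\in X$ such that the involution $[-1]\circ t_x$ on $C$ has exactly $12$ fixed points if and only if the Sylow $2$-subgroup of $X$ is not cyclic.
   Context: Everything is over $\mathbb{C}$. On an abelian variety, $t_x$ is translation by $x$ and $[-1]$ is the inverse map, so $[-1]\circ t_x$ is the map $a\mapsto -a-x$. Construction of $C$. Let $d\ge 1$ and let $A=V/\Lambda$ be an abelian surface with a polarization of type $(1,d)$, with alternating form $E:V\times V\to\mathbb{R}$ (integer valued on $\Lambda$). For an ample line bundle $L$ in this class, put $\varphi_L:A\to A^\vee$, $a\mapsto t_a^*L\otimes L^{-1}$, and $K(L)=\ker\varphi_L\cong(\mathbb{Z}/d\mathbb{Z})^2$ (depending only on the class). Let $X\le K(L)$ be a subgroup of order $d$ and $\pi:A\to A/X=V/\Lambda'$ the quotient isogeny, $\Lambda\subseteq\Lambda'$. Then $E$ also defines a principal polarization on $A/X$. Choose a real decomposition $V=V_1\oplus V_2$ into $E$-isotropic subspaces with $\Lambda=(\Lambda\cap V_1)\oplus(\Lambda\cap V_2)$ and $\Lambda'=(\Lambda'\cap V_1)\oplus(\Lambda'\cap V_2)$ (such a choice exists). Let $L$ on $A$ and $M$ on $A/X$ be the line bundles of characteristic $0$ for this decomposition, i.e. those with first Chern class $E$ and semicharacter $\chi_0(v_1+v_2)=\exp(\pi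 i E(v_1,v_2))$ for $v_i\in V_i$; they are symmetric and $\pi^*M\cong L$. Assume $(A/X,M)$ is the Jacobian of a smooth genus $2$ curve, i.e. the unique effective divisor $H\in|M|$ is a smooth curve of genus $2$. Set $C:=\pi^{-1}(H)\in|L|$. Then $C$ is a smooth curve, $\pi|_C:C\to H$ is an unramified covering with group $X$, and the maps $t_x$ and $[-1]\circ t_x$ for $x\in X$ restrict to automorphisms of $C$. *)

(* Defs.v *)
From HB Require Import structures.
From mathcomp Require Import all_boot all_order all_algebra ring_quotient.
From mathcomp Require Import complex.
From mathcomp Require Import all_classical all_reals all_analysis.

Set Implicit Arguments.
Unset Strict Implicit.
Unset Printing Implicit Defensive.

Import Order.TTheory GRing.Theory Num.Theory numFieldNormedType.Exports.

Local Open Scope classical_set_scope.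
Local Open Scope quotient_scope.
Local Open Scope ring_scope.

Notation "{ 'quot' I }" := (Quotient.quot I) (format "{ 'quot'  I }") : type_scope.

Section AbelianSurfaces.
Variable R : realType.

(* R[i] gets its topology as R[i]^o, the normed module over itself. *)
Local Notation C := R[i].
Local Notation V := 'rV[R[i]^o]_2.

(* As in Griffiths-Harris: continuously differentiable with C-linear
   differential ([differentiable] is over the scalar field R[i]). By Goursat's
   theorem the continuity of the partial derivatives is automatic. *)
Definition holomorphic_on (U : set V) (f : V -> C^o) : Prop :=
  forall v, U v ->
    differentiable f v /\ forall u : V, 'D_u f @ v --> 'D_u f v.

Definition holomorphic (f : V -> C) : Prop := holomorphic_on setT f.

Definition cexp (z : C) : C :=
  (let: x +i* y := z in (expR x * cos y) +i* (expR x * sin y))%C.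

(* The Z-span of a basis of V = C^2 as a 4-dimensional real vector space. *)
Definition lattice (Lam : set V) : Prop :=
  exists b : 'I_4 -> V,
    (forall v, exists! a : 'I_4 -> R, v = \sum_(i < 4) (a i)%:C%C *: b i) /\
    Lam = [set v | exists n : 'I_4 -> int, v = \sum_(i < 4) b i *~ n i].

(* A polarization of V/Lam, given by its first Chern class E. The positivity
   convention is that of Birkenhake-Lange: the hermitian form [herm E] below,
   with imaginary part E, is positive definite. *)
Record polarization (Lam : set V) (E : V -> V -> R) : Prop := Polarization {
  pol_linearl : forall (a : R) u v w,
    E (a%:C%C *: u + v) w = a * E u w + E v w;
  pol_linearr : forall (a : R) u v w,
    E w (a%:C%C *: u + v) = a * E w u + E w v;
  pol_alternating : forall v, E v v = 0;
  pol_integral : forall l m, Lam l -> Lam m -> E l m \is a Num.int;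
  pol_hermitian : forall u v, E ('i%C *: u) ('i%C *: v) = E u v;
  pol_positive : forall v, v != 0 -> 0 < E ('i%C *: v) v }.

Definition polarization_type (Lam : set V) (E : V -> V -> R) (d1 d2 : nat) :=
  exists l m : 'I_2 -> V,
    [/\ Lam = [set v | exists n k : 'I_2 -> int,
                 v = \sum_(i < 2) (l i *~ n i + m i *~ k i)],
        forall i j, E (l i) (l j) = 0,
        forall i j, E (m i) (m j) = 0 &
        forall i j, E (l i) (m j) =
          (if i == j then if i == ord0 then d1 else d2 else 0%N)%:R].

(* The line bundle with factor e is the quotient of V x C by
   l.(v, t) = (v + l, e l v * t); a trivialization is an isomorphism from the
   trivial bundle. Only the values e l v with l in Lam matter. *)
Definition trivial_factor (Lam : set V) (e : V -> V -> C) : Prop :=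
  exists h : V -> C,
    [/\ holomorphic h, forall v, h v != 0 &
        forall l v, Lam l -> h (v + l) = e l v * h v].

Definition translate_factor (a : V) (e : V -> V -> C) : V -> V -> C :=
  fun l v => e l (v + a).

Definition herm (E : V -> V -> R) (u v : V) : C :=
  (E ('i%C *: u) v +i* E u v)%C.

(* The canonical (Appell-Humbert) factor of the line bundle with first Chern
   class E and semicharacter chi. *)
Definition canonical_factor (E : V -> V -> R) (chi : V -> C) : V -> V -> C :=
  fun l v =>
    chi l * cexp ((pi)%:C%C * herm E v l + (pi / 2)%:C%C * herm E l l).

(* K(L) = ker(a |-> t_a^* L (x) L^-1), L being given by the factor e. *)
Definition K_of (Lam : zmodClosed V) (e : V -> V -> C) : set {quot Lam} :=
  [set x | exists2 a : V, x = \pi a &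
     trivial_factor [set` Lam]
       (fun l v => translate_factor a e l v * (e l v)^-1)].

Definition section_of (Lam : set V) (e : V -> V -> C) (theta : V -> C) : Prop :=
  holomorphic theta /\
  forall l v, Lam l -> theta (v + l) = e l v * theta v.

Definition real_subspace (W : set V) : Prop :=
  W 0 /\ forall (a : R) u v, W u -> W v -> W (a%:C%C *: u + v).

Definition isotropic (E : V -> V -> R) (W : set V) : Prop :=
  forall u v, W u -> W v -> E u v = 0.

Record isotropic_decomposition (E : V -> V -> R) (V1 V2 : set V) : Prop :=
  IsotropicDecomposition {
    dec_subspace1 : real_subspace V1;
    dec_subspace2 : real_subspace V2;
    dec_isotropic1 : isotropic E V1;
    dec_isotropic2 : isotropic E V2;
    dec_sum : forall v, exists v1 v2, [/\ V1 v1, V2 v2 & v = v1 + v2];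
    dec_direct : V1 `&` V2 = [set 0] }.

Definition decomposes (V1 V2 Lam : set V) : Prop :=
  Lam = [set l1 + l2 | l1 in Lam `&` V1 & l2 in Lam `&` V2].

(* The component of v in V1 along V2. *)
Definition component (V1 V2 : set V) (v : V) : V :=
  xget 0 [set v1 | V1 v1 /\ V2 (v - v1)].

Definition chi0 (E : V -> V -> R) (V1 V2 : set V) (v : V) : C :=
  cexp (0 +i* (pi * E (component V1 V2 v) (component V2 V1 v)))%C.

Definition zeros (theta : V -> C) : set V := [set v | theta v = 0].

Definition derive_along (theta : V -> C^o) (u v : V) : C := 'D_u theta v.

Definition smooth_divisor (theta : V -> C) : Prop :=
  forall v, zeros theta v -> exists u, derive_along theta u v != 0.

Definition tangent (theta : V -> C) (v : V) : set V :=
  [set u | derive_along theta u v = 0].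

(* The image of Z in V/Lam is connected for the quotient topology: the open
   subsets of V/Lam are the images of the Lam-invariant open subsets of V. *)
Definition connected_mod (Lam Z : set V) : Prop :=
  forall U1 U2 : set V, open U1 -> open U2 ->
    (forall l v, Lam l -> U1 v -> U1 (v + l)) ->
    (forall l v, Lam l -> U2 v -> U2 (v + l)) ->
    Z `<=` U1 `|` U2 -> Z `&` U1 !=set0 -> Z `&` U2 !=set0 ->
    Z `&` U1 `&` U2 !=set0.

(* A holomorphic 1-form on the smooth curve {theta = 0}/Lam, pulled back to V:
   w v u is its value at the zero v of theta on the tangent vector u; locally it
   is the restriction of a holomorphic 1-form g_0 dz_0 + g_1 dz_1 of V. *)
Definition holomorphic_form (Lam : set V) (theta : V -> C)
    (w : V -> V -> C) : Prop :=
  (forall v, zeros theta v -> exists (U : set V) (g : 'I_2 -> V -> C),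
     [/\ open U, U v, forall j, holomorphic_on U (g j) &
         forall v' u, U v' -> zeros theta v' -> tangent theta v' u ->
           w v' u = \sum_(j < 2) g j v' * u 0 j]) /\
  (forall l v u, Lam l -> zeros theta v -> tangent theta v u ->
     w (v + l) u = w v u).

(* The space of holomorphic 1-forms of {theta = 0}/Lam has dimension g. *)
Definition genus (Lam : set V) (theta : V -> C) (g : nat) : Prop :=
  exists b : 'I_g -> V -> V -> C,
    (forall i, holomorphic_form Lam theta (b i)) /\
    forall w, holomorphic_form Lam theta w ->
      exists! c : 'I_g -> C, forall v u, zeros theta v -> tangent theta v u ->
        w v u = \sum_(i < g) c i * b i v u.

Definition smooth_curve_of_genus (Lam : set V) (theta : V -> C) (g : nat) :=
  [/\ smooth_divisor theta, connected_mod Lam (zeros theta) &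
      genus Lam theta g].

Definition preimage_lattice (Lam : zmodClosed V) (X : zmodClosed {quot Lam}) :
    set V :=
  [set v | \pi_{quot Lam} v \in X].

Definition divisor_in_quotient (Lam : zmodClosed V)
    (X : zmodClosed {quot Lam}) (theta : V -> C) : set {quot X} :=
  [set \pi_{quot X} (\pi_{quot Lam} v) | v in zeros theta].
Arguments divisor_in_quotient {Lam} X theta.

Definition covering_curve (Lam : zmodClosed V)
    (X : zmodClosed {quot Lam}) (theta : V -> C) : set {quot Lam} :=
  \pi_{quot X} @^-1` divisor_in_quotient X theta.

End AbelianSurfaces.
Arguments K_of {R} Lam e.
Arguments preimage_lattice {R Lam} X.
Arguments covering_curve {R Lam} X theta.


Definition has_order (G : zmodType) (S : {pred G}) (n : nat) : Prop :=
  ([set` S] #= `I_n)%card.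

Definition cyclic_subgroup (G : zmodType) (S : {pred G}) : Prop :=
  exists g : G, forall x, x \in S <-> exists n : int, x = g *~ n.

Definition sylow_subgroup (G : zmodType) (p : nat) (X S : zmodClosed G) : Prop :=
  {subset S <= X} /\
  exists2 n, has_order X n & has_order S (p ^ logn p n)%N.

Definition translation (G : zmodType) (x : G) : G -> G := fun a => a + x.

Definition fixed_points_in (T : Type) (S : set T) (f : T -> T) : set T :=
  [set a | S a /\ f a = a].

(* Main.v *)
(* The fixed points of [-1] t_x on A are the points l/2 + Lam with l in Lam' of
   class -x modulo Lam, so they lie over two-torsion points of A/X. The theta
   function defining H is even: after multiplication by the exponential of a
   quadratic form it becomes periodic under Lam' /\ V1, translation by Lam' /\ V2
   shifts its Fourier coefficients, and so an odd section of M, whose zeroth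
   coefficient vanishes, is zero. Hence theta (l/2) = 0 whenever the
   semicharacter chi0 is -1 at l, and by smoothness of H only then; that is,
   l/2 lies on H if and only if E (l_1, l_2) is odd, l_i being the components
   of l in V_i.

   Lam' has a symplectic basis e1, e2 in V1, f1, f2 in V2 for which Lam is
   spanned by e1, s e2, f1, t f2 with s t = d, so that X = Z/s x Z/t. Counting
   the classes of l modulo 2 Lam with E (l_1, l_2) odd gives 12 for the class
   of e2 + f2 when s and t are both even, and 4 or 8 for every class when
   exactly one of them is even.

   Fourier coefficients are replaced by the means of a function over the grids
   (Z/N)^2. A mean value estimate shows that for a periodic holomorphic
   function they become translation invariant as N grows, which avoids
   integration. *)
Require Import Defs.
From HB Require Import structures.
From mathcomp Require Import all_boot all_order all_algebra ring_quotient.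
From mathcomp Require Import complex.
From mathcomp Require Import all_classical all_reals all_analysis.
From mathcomp Require Import ring lra zify.

Import Order.TTheory GRing.Theory Num.Theory numFieldNormedType.Exports.
Local Open Scope classical_set_scope.
Local Open Scope ring_scope.

Set Implicit Arguments.
Unset Strict Implicit.
Unset Printing Implicit Defensive.

Import ComplexField.Normc.
Local Notation Re := complex.Re.
Local Notation Im := complex.Im.

(** * Complex exponential and complex-valued calculus *)

Section ComplexCalculus.
Variable R : realType.
Local Notation C := R[i].
Implicit Types (z w : C) (x y t : R).

(** Fourier coefficients exist here only as limits of grid means. A coefficient vanishes if the
    means over grids based at every point (z, w) of C^2 tend to 0, and moving the base point changes
    a mean by an amount that merely tends to 0. Uniqueness is obtained by testing against Fejer
    kernels, where positivity and known mass suffice.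

    Two facts about [E] on Lam' are derived: it is integral there because a nonzero section
    satisfies the cocycle condition, and principal because a frame gives d = s t g, with g the
    remaining elementary divisor, while X has s t elements.

    The number 12 is 4 times 3. A class has 16 halves modulo Lam, indexed by four bits. The first
    two bits x, y contribute x y to the parity of E (l_1, l_2); for s and t even the other two
    contribute the constant al be, where (al, be) is the class in Z/s x Z/t. If al be is odd, x y
    must be even: 3 choices, with the last two bits free. For s even and t odd the second
    contribution is 0 or an equidistributed bit, whence 4 or 8. *)

Lemma cReD z w : Re (z + w) = Re z + Re w. Proof. by case: z; case: w. Qed.
Lemma cImD z w : Im (z + w) = Im z + Im w. Proof. by case: z; case: w. Qed.
Lemma cReN z : Re (- z) = - Re z. Proof. by case: z. Qed.
Lemma cImN z : Im (- z) = - Im z. Proof. by case: z. Qed.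
Lemma cReM z w : Re (z * w) = Re z * Re w - Im z * Im w.
Proof. by case: z; case: w. Qed.
Lemma cImM z w : Im (z * w) = Re z * Im w + Im z * Re w.
Proof. by case: z; case: w. Qed.

Lemma complex_eq z w : Re z = Re w -> Im z = Im w -> z = w.
Proof. by case: z w => [a b] [c e] /= -> ->. Qed.

Lemma normc_ge0 z : 0 <= normc z.
Proof. by case: z => a b; rewrite sqrtr_ge0. Qed.

Lemma normc_sqr z : normc z ^+ 2 = Re z ^+ 2 + Im z ^+ 2.
Proof. by case: z => a b; rewrite sqr_sqrtr // addr_ge0 ?sqr_ge0. Qed.

Lemma normc_real x : normc x%:C%C = `|x|.
Proof. by rewrite /= expr0n /= addr0 sqrtr_sqr. Qed.

Lemma normc_le z : normc z <= `|Re z| + `|Im z|.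
Proof.
rewrite -(ler_pXn2r (n := 2)) // ?nnegrE ?normc_ge0 ?addr_ge0 //.
rewrite normc_sqr -(real_normK (num_real (Re z))) -(real_normK (num_real (Im z))).
have := mulr_ge0 (normr_ge0 (Re z)) (normr_ge0 (Im z)); nra.
Qed.

Lemma Re_normc z : `|Re z| <= normc z.
Proof.
rewrite -(ler_pXn2r (n := 2)) // ?nnegrE ?normc_ge0 //.
by rewrite normc_sqr real_normK ?num_real // lerDl sqr_ge0.
Qed.

Lemma Im_normc z : `|Im z| <= normc z.
Proof.
rewrite -(ler_pXn2r (n := 2)) // ?nnegrE ?normc_ge0 //.
by rewrite normc_sqr real_normK ?num_real // lerDr sqr_ge0.
Qed.

Lemma normc_sum (I : Type) (r : seq I) (P : pred I) (F : I -> C) :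
  normc (\sum_(i <- r | P i) F i) <= \sum_(i <- r | P i) normc (F i).
Proof. exact: (@ler_norm_sum R (Rcomplex R)). Qed.

Lemma cexpD z w : cexp (z + w) = cexp z * cexp w.
Proof.
case: z w => [a b] [c e]; rewrite /cexp /= expRD cosD sinD.
by apply: complex_eq => /=; ring.
Qed.

Lemma cexp0 : cexp (0 : C) = 1.
Proof. by rewrite /cexp /= expR0 cos0 sin0; apply: complex_eq => /=; ring. Qed.

Lemma normc_cexp z : normc (cexp z) = expR (Re z).
Proof.
case: z => a b /=; rewrite !exprMn -mulrDr cos2Dsin2 mulr1 sqrtr_sqr.
by rewrite ger0_norm ?expR_ge0.
Qed.

Lemma cexp_neq0 z : cexp z != 0.
Proof.
apply/eqP => /(congr1 (@normc R)); rewrite normc_cexp normc0.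
by move/eqP; rewrite gt_eqF ?expR_gt0.
Qed.

Lemma cexpN z : cexp (- z) = (cexp z)^-1.
Proof.
by apply: (mulfI (cexp_neq0 z)); rewrite -cexpD subrr cexp0 mulfV ?cexp_neq0.
Qed.

Lemma cexpMz z (n : int) : cexp (z * n%:~R) = cexp z ^ n.
Proof.
have H (m : nat) : cexp (z * m%:R) = cexp z ^+ m.
  elim: m => [|m IH]; first by rewrite mulr0 cexp0.
  by rewrite -addn1 natrD mulrDr mulr1 cexpD IH exprD expr1.
case: n => m; first by rewrite -exprnP -H.
by rewrite NegzE -exprnN -H -cexpN mulrNz mulrN.
Qed.

Lemma cexp_2pi_int (n : int) : cexp (0 +i* (pi * 2 * n%:~R))%C = 1 :> C.
Proof.
have -> : (0 +i* (pi * 2 * n%:~R))%C = (0 +i* (pi *+ 2))%C * n%:~R :> C.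
  have -> : n%:~R = (n%:~R : R)%:C%C :> C by rewrite rmorph_int.
  by apply: complex_eq; rewrite ?cReM ?cImM /= -[pi *+ 2]mulr_natr; ring.
rewrite cexpMz /cexp /= expR0 cos2pi sin2pi.
by rewrite (_ : (_ +i* _)%C = 1) ?exp1rz //; apply: complex_eq => /=; ring.
Qed.

(** If the fractional part [f] is positive, then 0 < pi f < pi and cos (2 pi f) = 1 - 2 sin^2 (pi f)
    < 1. *)
Lemma cexp_2pi_eq1 x : cexp (0 +i* (pi * 2 * x))%C = 1 :> C -> x \is a Num.int.
Proof.
move=> H.
have : cexp (0 +i* (pi * 2 * (x - (Num.floor x)%:~R)))%C = 1 :> C.
  have -> : (0 +i* (pi * 2 * (x - (Num.floor x)%:~R)))%C =
      (0 +i* (pi * 2 * x))%C + (0 +i* (pi * 2 * (- Num.floor x)%:~R))%C :> C.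
    by apply: complex_eq => /=; rewrite ?rmorphN /=; ring.
  by rewrite cexpD H cexp_2pi_int mulr1.
set f := x - _ => Hf.
have f0 : 0 <= f by rewrite subr_ge0 Num.Theory.ge_floor.
have f1 : f < 1.
  by have := Num.Theory.floorD1_gt x; rewrite rmorphD /= /f => ?; lra.
move: f0; rewrite le_eqVlt => /orP[/eqP f0|f0].
  by rewrite -(subrK (Num.floor x)%:~R x) -/f -f0 add0r intr_int.
have s0 : 0 < sin (pi * f).
  by apply: sin_gt0_pi; rewrite mulr_gt0 ?pi_gt0 //= gtr_pMr ?pi_gt0.
move: Hf => /(congr1 (@Re R)) /=; rewrite expR0 mul1r.
have -> : pi * 2 * f = (pi * f) *+ 2 by rewrite -mulr_natr; ring.
rewrite cos_mulr2n cos2sin2; move: s0 => /(exprn_gt0 2); rewrite -mulr_natr; lra.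
Qed.

Section ContinuousC.
Variable T : topologicalType.
Implicit Types f g : T -> C.

Definition ccont f :=
  continuous (fun a => Re (f a)) /\ continuous (fun a => Im (f a)).

Lemma ccont_cst z : ccont (fun=> z).
Proof. by split => a; exact: cvg_cst. Qed.

Lemma ccontD f g : ccont f -> ccont g -> ccont (fun a => f a + g a).
Proof.
move=> [f1 f2] [g1 g2]; split => a.
  under eq_fun do rewrite cReD.
  by apply: cvgD; [exact: f1|exact: g1].
under eq_fun do rewrite cImD.
by apply: cvgD; [exact: f2|exact: g2].
Qed.

Lemma ccontM f g : ccont f -> ccont g -> ccont (fun a => f a * g a).
Proof.
move=> [f1 f2] [g1 g2]; split => a.
  under eq_fun do rewrite cReM.
  by apply: cvgB; apply: cvgM; [exact: f1|exact: g1|exact: f2|exact: g2].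
under eq_fun do rewrite cImM.
by apply: cvgD; apply: cvgM; [exact: f1|exact: g2|exact: f2|exact: g1].
Qed.

Lemma ccont_real (h : T -> R) : continuous h -> ccont (fun a => (h a)%:C%C).
Proof. by move=> h1; split => //= a; exact: cvg_cst. Qed.

Lemma ccont_cexp f : ccont f -> ccont (fun a => cexp (f a)).
Proof.
move=> [f1 f2].
have E : (fun a => cexp (f a)) =
    fun a => ((expR (Re (f a)) * cos (Im (f a))) +i*
              (expR (Re (f a)) * sin (Im (f a))))%C.
  by apply/funext => a; case: (f a).
rewrite E; split => a /=; apply: cvgM.
- by apply: continuous_comp; [exact: f1|exact: continuous_expR].
- by apply: continuous_comp; [exact: f2|exact: continuous_cos].
- by apply: continuous_comp; [exact: f1|exact: continuous_expR].
- by apply: continuous_comp; [exact: f2|exact: continuous_sin].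
Qed.

Lemma ccont_normc f : ccont f -> continuous (fun a => normc (f a)).
Proof.
move=> [f1 f2].
have E : (fun a => normc (f a)) =
    fun a => Num.sqrt (Re (f a) * Re (f a) + Im (f a) * Im (f a)).
  by apply/funext => a; case: (f a).
rewrite E => a.
apply: (@continuous_comp _ _ _ (fun a => _ + _) Num.sqrt);
  last exact: sqrt_continuous.
by apply: cvgD; apply: cvgM; [exact: f1|exact: f1|exact: f2|exact: f2].
Qed.

End ContinuousC.

(** Taken componentwise, so that the real differentiation rules and the real mean value theorem
    apply. *)
Definition cderiv (f : R -> C) (t : R) (l : C) :=
  is_derive t 1 (fun s => Re (f s)) (Re l) /\
  is_derive t 1 (fun s => Im (f s)) (Im l).

Lemma cderiv_cst z t : cderiv (fun=> z) t 0.
Proof. by split; exact: is_derive_cst. Qed.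

Lemma cderiv_real t : cderiv (fun s => s%:C%C) t 1.
Proof. by split; [exact: is_derive_id|exact: is_derive_cst]. Qed.

Lemma cderivD f g t k l : cderiv f t k -> cderiv g t l ->
  cderiv (fun s => f s + g s) t (k + l).
Proof.
move=> [f1 f2] [g1 g2]; split.
  under eq_fun do rewrite cReD.
  by rewrite cReD; exact: is_deriveD.
under eq_fun do rewrite cImD.
by rewrite cImD; exact: is_deriveD.
Qed.

Lemma cderivM f g t k l : cderiv f t k -> cderiv g t l ->
  cderiv (fun s => f s * g s) t (k * g t + f t * l).
Proof.
move=> [f1 f2] [g1 g2]; split.
  under eq_fun do rewrite cReM.
  apply: (is_derive_eq (is_deriveB (is_deriveM f1 g1) (is_deriveM f2 g2))).
  by rewrite cReD !cReM /GRing.scale /=; ring.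
under eq_fun do rewrite cImM.
apply: (is_derive_eq (is_deriveD (is_deriveM f1 g2) (is_deriveM f2 g1))).
by rewrite cImD !cImM /GRing.scale /=; ring.
Qed.

Lemma cderiv_sum (n : nat) (f : 'I_n -> R -> C) (l : 'I_n -> C) t :
  (forall i, cderiv (f i) t (l i)) ->
  cderiv (fun s => \sum_(i < n) f i s) t (\sum_(i < n) l i).
Proof.
elim: n f l => [|n IH] f l H.
  under eq_fun do rewrite big_ord0.
  by rewrite big_ord0; exact: cderiv_cst.
under eq_fun do rewrite big_ord_recl.
rewrite big_ord_recl; apply: cderivD; first exact: H.
by apply: IH => i; exact: H.
Qed.

Lemma cderiv_cexp f t l : cderiv f t l ->
  cderiv (fun s => cexp (f s)) t (l * cexp (f t)).
Proof.
move=> [f1 f2].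
have E : (fun a => cexp (f a)) =
    fun a => ((expR (Re (f a)) * cos (Im (f a))) +i*
              (expR (Re (f a)) * sin (Im (f a))))%C.
  by apply/funext => a; case: (f a).
have e1 := is_derive1_comp (is_derive_expR (Re (f t))) f1.
have c1 := is_derive1_comp (is_derive_cos (Im (f t))) f2.
have s1 := is_derive1_comp (is_derive_sin (Im (f t))) f2.
have Et : cexp (f t) = ((expR (Re (f t)) * cos (Im (f t))) +i*
              (expR (Re (f t)) * sin (Im (f t))))%C by case: (f t).
rewrite E Et.
split => /=.
  apply: (is_derive_eq (is_deriveM e1 c1)).
  by rewrite cReM /GRing.scale /=; ring.
apply: (is_derive_eq (is_deriveM e1 s1)).
by rewrite cImM /GRing.scale /=; ring.
Qed.

(* The mean value theorem is applied to the real and imaginary parts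
   separately, whence the factor 2. *)
Lemma cmean_value (f f' : R -> C) (c : C) (eta : R) :
  (forall t, 0 <= t <= 1 -> cderiv f t (f' t)) ->
  (forall t, 0 <= t <= 1 -> normc (f' t - c) <= eta) ->
  normc (f 1 - f 0 - c) <= eta + eta.
Proof.
move=> fd fb.
have itv t : t \in `]0, 1[ -> 0 <= t <= 1.
  by rewrite in_itv /= => /andP[/ltW -> /ltW ->].
have cont (h h' : R -> R) : (forall t, 0 <= t <= 1 -> is_derive t 1 h (h' t)) ->
    {within `[0, 1], continuous h}.
  move=> hd; apply: continuous_in_subspaceT => t; rewrite inE /= in_itv /= => ht.
  by have [dh _] := hd t ht; apply/differentiable_continuous/derivable1_diffP.
have [||t1 /itv h1] := @MVT R (fun s => Re (f s)) (fun s => Re (f' s)) 0 1 ltr01.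
- by move=> t /itv /fd [].
- by apply: (cont _ (fun s => Re (f' s))) => t /fd [].
have [||t2 /itv h2] := @MVT R (fun s => Im (f s)) (fun s => Im (f' s)) 0 1 ltr01.
- by move=> t /itv /fd [].
- by apply: (cont _ (fun s => Im (f' s))) => t /fd [].
rewrite subr0 !mulr1 => e2 e1.
apply: le_trans (normc_le _) _.
rewrite !cReD !cImD !cReN !cImN e1 e2.
apply: lerD.
  by apply: le_trans (fb _ h1); rewrite -cReN -cReD; exact: Re_normc.
by apply: le_trans (fb _ h2); rewrite -cImN -cImD; exact: Im_normc.
Qed.

End ComplexCalculus.

(** * Grid means *)

Section GridMeans.
Variable R : realType.
Local Notation C := R[i].
Implicit Types (F D : C -> C -> C) (z w lam : C).

(* Continuity of a function on C x C, tested on continuous families. *)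
Definition cts2 F := forall (T : topologicalType) (a b : T -> C),
  ccont a -> ccont b -> ccont (fun t => F (a t) (b t)).

(** Holomorphy in the first variable: the Cauchy-Riemann equations are contained in the requirement
    that any complex direction [lam] factors out of the derivative. *)
Definition hol1 F D := cts2 D /\ forall z w lam t,
  cderiv (fun s => F (z + s%:C%C * lam) w) t (lam * D (z + t%:C%C * lam) w).

Definition grid (N a : nat) : C := (a%:R / N%:R)%:C%C.

Definition gmean (N : nat) F z w : C :=
  (N%:R^-1)%:C%C * ((N%:R^-1)%:C%C *
    \sum_(b < N) \sum_(a < N) F (z + grid N a) (w + grid N b)).

Definition vanishing (u : nat -> C) :=
  forall eps : R, 0 < eps -> \forall N \near \oo, normc (u N) <= eps.

Lemma itv01_compact3 :
  compact ((`[(0:R), 1] `*` `[(0:R), 1]) `*` `[(0:R), 1]).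
Proof.
by apply: compact_setX; [apply: compact_setX|]; exact: segment_compact.
Qed.

Lemma fst_continuous (T U : topologicalType) : continuous (@fst T U).
Proof. by move=> x; exact: cvg_fst. Qed.

Lemma snd_continuous (T U : topologicalType) : continuous (@snd T U).
Proof. by move=> x; exact: cvg_snd. Qed.

Lemma continuous_compose (T U V : topologicalType) (g : U -> V) (f : T -> U) :
  continuous g -> continuous f -> continuous (fun x => g (f x)).
Proof. by move=> gc fc x; apply: (continuous_comp (fc x)); exact: gc. Qed.

(** Compactness of the cube of parameters: [t] moves along the segment of a translation by [lam],
    [s] and [r] along the second and first side of the grid square, and [h] is the offset inside a
    grid cell. *)
Lemma cts2_uniform D z w lam (eta : R) : cts2 D -> 0 < eta ->
  \forall h \near (0 : R), forall s t r : R,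
    0 <= s <= 1 -> 0 <= t <= 1 -> 0 <= r <= 1 ->
    normc (D (z + t%:C%C * lam + r%:C%C + h%:C%C) (w + s%:C%C) -
           D (z + t%:C%C * lam + r%:C%C) (w + s%:C%C)) <= eta.
Proof.
move=> Dc eta0.
pose G (x : (R * R * R) * R) := normc
  (D (z + (x.1.1.2)%:C%C * lam + (x.1.2)%:C%C + (x.2)%:C%C) (w + (x.1.1.1)%:C%C) -
   D (z + (x.1.1.2)%:C%C * lam + (x.1.2)%:C%C) (w + (x.1.1.1)%:C%C)).
have c0 : continuous (fun x : (R * R * R) * R => x.1.1).
  exact: continuous_compose (@fst_continuous _ _) (@fst_continuous _ _).
have c1 : continuous (fun x : (R * R * R) * R => x.1.1.1).
  exact: continuous_compose (@fst_continuous _ _) c0.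
have c2 : continuous (fun x : (R * R * R) * R => x.1.1.2).
  exact: continuous_compose (@snd_continuous _ _) c0.
have c3 : continuous (fun x : (R * R * R) * R => x.1.2).
  exact: continuous_compose (@snd_continuous _ _) (@fst_continuous _ _).
have c4 : continuous (fun x : (R * R * R) * R => x.2) by exact: snd_continuous.
have Gc : continuous G.
  apply: ccont_normc.
  have b1 : ccont (fun x : (R * R * R) * R => w + (x.1.1.1)%:C%C).
    by apply: ccontD; [exact: ccont_cst|exact: ccont_real].
  have a1 : ccont (fun x : (R * R * R) * R =>
      z + (x.1.1.2)%:C%C * lam + (x.1.2)%:C%C).
    apply: ccontD; last exact: ccont_real.
    apply: ccontD; first exact: ccont_cst.
    by apply: ccontM; [exact: ccont_real|exact: ccont_cst].
  have a2 : ccont (fun x : (R * R * R) * R =>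
      z + (x.1.1.2)%:C%C * lam + (x.1.2)%:C%C + (x.2)%:C%C).
    by apply: ccontD => //; exact: ccont_real.
  apply: ccontD; first exact: Dc.
  under eq_fun do rewrite -mulN1r.
  by apply: ccontM; [exact: ccont_cst|exact: Dc].
have /compact_near_coveringP K := itv01_compact3.
have := K R (nbhs (0 : R)) (fun h x => G (x, h) <= eta) _.
move=> /(_ _)[|].
  move=> x _; have := Gc (x, 0); rewrite /continuous_at.
  have -> : G (x, 0) = 0 by rewrite /G /= addr0 subrr normc0.
  move=> /cvgr0_norm_le /(_ _ eta0); apply: filterS => -[a b].
  by rewrite /= ger0_norm // normc_ge0.
move=> /= del del0 H; exists del => // h /H Kh s t r hs ht hr.
by apply: (Kh (s, t, r)); split; first split; rewrite /= in_itv.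
Qed.

Section Translation.
Variables (F D : C -> C -> C).
Hypothesis FD : hol1 F D.
Hypothesis Fper : forall z w, F (z + 1) w = F z w.

(** The increments of [F] along a row telescope to F (p + 1) - F p = 0. Each of them is [D] / N at
    the left end of its cell up to the error of the mean value estimate, so the row mean of [D] is
    bounded by that error. *)
Lemma sum_derivative_bound N p w (eta : R) : (0 < N)%N ->
  (forall r h : R, 0 <= r <= 1 -> 0 <= h <= N%:R^-1 ->
     normc (D (p + r%:C%C + h%:C%C) w - D (p + r%:C%C) w) <= eta) ->
  normc ((N%:R^-1)%:C%C * \sum_(a < N) D (p + grid N a) w) <= eta + eta.
Proof.
move=> N0 H; set n1 : R := N%:R^-1.
have n10 : 0 < n1 by rewrite invr_gt0 ltr0n.
have gS a : grid N a.+1 = grid N a + n1%:C%C.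
  by rewrite /grid -rmorphD /= -(addn1 a) natrD mulrDl mul1r.
have step (a : 'I_N) : normc (F (p + grid N a.+1) w - F (p + grid N a) w -
    n1%:C%C * D (p + grid N a) w) <= n1 * eta + n1 * eta.
  have := @cmean_value R (fun s => F (p + grid N a + s%:C%C * n1%:C%C) w)
    (fun s => n1%:C%C * D (p + grid N a + s%:C%C * n1%:C%C) w)
    (n1%:C%C * D (p + grid N a) w) (n1 * eta).
  rewrite mul1r mul0r addr0 gS addrA; apply; first by move=> t _; exact: FD.2.
  move=> t /andP[t0 t1]; rewrite -mulrBr normcM normc_real gtr0_norm //.
  rewrite ler_pM2l // -rmorphM; apply: H; apply/andP; split.
  - by rewrite divr_ge0.
  - by rewrite ler_pdivrMr ?ltr0n // mul1r ler_nat ltnW.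
  - by rewrite mulr_ge0 // ltW.
  - by rewrite ler_piMl // ltW.
have tel : \sum_(a < N) (F (p + grid N a.+1) w - F (p + grid N a) w) = 0.
  rewrite -(big_mkord xpredT (fun a => F (p + grid N a.+1) w - F (p + grid N a) w)).
  rewrite telescope_sumr // /grid mul0r addr0 divff ?pnatr_eq0 -?lt0n //.
  by rewrite Fper subrr.
rewrite -normcN.
have -> : (- ((N%:R^-1)%:C%C * \sum_(a < N) D (p + grid N a) w) : C) =
    \sum_(a < N) (F (p + grid N a.+1) w - F (p + grid N a) w -
      n1%:C%C * D (p + grid N a) w).
  by rewrite sumrB tel sub0r mulr_sumr.
apply: le_trans (normc_sum _ _ _) _.
apply: le_trans (ler_sum _ (fun a _ => step a)) _.
rewrite sumr_const card_ord -mulr_natl -mulrDr mulrA divff ?mul1r //.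
by rewrite pnatr_eq0 -lt0n.
Qed.

(** Along the segment from z to z + lam the mean of [F] has derivative [lam] times the mean of [D],
    which is uniformly small by telescoping. *)
Lemma gmean_translate z w lam :
  vanishing (fun N => gmean N F (z + lam) w - gmean N F z w).
Proof.
move=> eps eps0; set L := normc lam.
have L0 : 0 <= L by exact: normc_ge0.
(* The 4 absorbs one factor 2 from [sum_derivative_bound] and another from [cmean_value]; L + 1
   keeps the denominator positive. *)
pose eta := eps / (4 * (L + 1)).
have eta0 : 0 < eta by rewrite divr_gt0 // mulr_gt0 // ltr_wpDl.
have [del /= del0 Hdel] := cts2_uniform z w lam FD.1 eta0.
near=> N.
have N0 : (0 < N)%N by near: N; exists 1%N.
have n10 : (0 : R) < N%:R^-1 by rewrite invr_gt0 ltr0n.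
have Ndel : N%:R^-1 < del.
  rewrite invf_plt ?posrE ?ltr0n //.
  near: N; exact: nbhs_infty_gtr.
pose f t := gmean N F (z + t%:C%C * lam) w.
pose f' t := lam * gmean N D (z + t%:C%C * lam) w.
have fd t : 0 <= t <= 1 -> cderiv f t (f' t).
  move=> _; rewrite /f /f' /gmean.
  have dc (k : C) (g : R -> C) (l : C) : cderiv g t l ->
      cderiv (fun s => k * g s) t (k * l).
    by move=> gl; rewrite -[k * l]add0r -(mul0r (g t));
      apply: cderivM => //; exact: cderiv_cst.
  rewrite !(mulrCA lam); apply: (dc); apply: (dc).
  rewrite mulr_sumr; apply: cderiv_sum => b.
  rewrite mulr_sumr; apply: cderiv_sum => a.
  rewrite addrAC.
  under eq_fun do rewrite addrAC.
  exact: FD.2.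
have fb t : 0 <= t <= 1 -> normc (f' t - 0) <= L * (eta + eta).
  move=> t01; rewrite subr0 /f' normcM ler_wpM2l //.
  rewrite /gmean normcM normc_real gtr0_norm // mulr_sumr.
  rewrite ler_pdivrMl ?ltr0n //.
  apply: le_trans (normc_sum _ _ _) _.
  have H (b : 'I_N) : normc ((N%:R^-1)%:C%C * \sum_(a < N)
      D (z + t%:C%C * lam + grid N a) (w + grid N b)) <= eta + eta.
    apply: sum_derivative_bound => // r h r01 /andP[h0 hN]; apply: Hdel => //.
      by rewrite /= sub0r normrN ger0_norm // (le_lt_trans hN).
    by rewrite divr_ge0 //= ler_pdivrMr ?ltr0n // mul1r ler_nat ltnW.
  apply: le_trans (ler_sum _ (fun b _ => H b)) _.
  by rewrite sumr_const card_ord mulr_natl.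
have := cmean_value fd fb; rewrite subr0 /f mul1r mul0r addr0.
move=> /le_trans; apply.
have -> : L * (eta + eta) + L * (eta + eta) = eps * (L / (L + 1)).
  by rewrite /eta; field; rewrite gt_eqF // ltr_wpDl.
rewrite ger_pMr // ler_pdivrMr ?mul1r; last by rewrite ltr_wpDl.
by rewrite lerDl.
Unshelve. all: by end_near. Qed.

End Translation.

Lemma gmean_swap N F z w : gmean N F z w = gmean N (fun x y => F y x) w z.
Proof. by rewrite /gmean exchange_big. Qed.

End GridMeans.

(** * Fejer kernels and Fourier uniqueness *)

Section FourierUniqueness.
Variable R : realType.
Local Notation C := R[i].
Implicit Types (F P : C -> C -> C) (z w : C) (u v : nat -> C).

Lemma vanishing_ext u v : vanishing u -> u =1 v -> vanishing v.
Proof. by move=> hu uv eps e0; under eq_near do rewrite -uv; exact: hu. Qed.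

Lemma vanishingD u v : vanishing u -> vanishing v ->
  vanishing (fun N => u N + v N).
Proof.
move=> hu hv eps e0; have e2 : 0 < eps / 2 by lra.
near=> N; apply: le_trans (le_normcD _ _) _.
rewrite (splitr eps); apply: lerD; near: N; [exact: hu|exact: hv].
Unshelve. all: by end_near. Qed.

Lemma vanishingZ (k : C) u : vanishing u -> vanishing (fun N => k * u N).
Proof.
move=> hu eps e0; have k1 : 0 < normc k + 1 by rewrite ltr_wpDl ?normc_ge0.
have e2 : 0 < eps / (normc k + 1) by rewrite divr_gt0.
near=> N; have : normc (u N) <= eps / (normc k + 1) by near: N; exact: hu.
rewrite ler_pdivlMr // normcM => H; apply: le_trans H.
by rewrite mulrC ler_wpM2l ?normc_ge0 // lerDl.
Unshelve. all: by end_near. Qed.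

Lemma vanishingN u : vanishing u -> vanishing (fun N => - u N).
Proof.
by move=> /(vanishingZ (-1)) /vanishing_ext; apply => N; rewrite mulN1r.
Qed.

Lemma vanishing_sum (n : nat) (u : 'I_n -> nat -> C) :
  (forall i, vanishing (u i)) -> vanishing (fun N => \sum_(i < n) u i N).
Proof.
elim: n u => [|n IH] u hu.
  move=> eps e0; near=> N; rewrite big_ord0 normc0; exact: ltW.
apply: (@vanishing_ext (fun N => u ord0 N + \sum_(i < n) u (lift ord0 i) N)).
  by apply: vanishingD => //; apply: IH => i.
by move=> N; rewrite big_ord_recl.
Unshelve. all: by end_near. Qed.

Definition ee z : C := cexp ((0 +i* (pi * 2))%C * z).

Lemma eeD z w : ee (z + w) = ee z * ee w.
Proof. by rewrite /ee mulrDr cexpD. Qed.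

Lemma ee0 : ee 0 = 1. Proof. by rewrite /ee mulr0 cexp0. Qed.

Lemma ee_realE (x : R) : ee x%:C%C = cexp (0 +i* (pi * 2 * x))%C.
Proof. by congr cexp; apply: complex_eq; rewrite ?cReM ?cImM /=; ring. Qed.

Lemma ee_int (n : int) : ee n%:~R = 1.
Proof.
have -> : (n%:~R : C) = (n%:~R : R)%:C%C by rewrite rmorph_int.
by rewrite ee_realE cexp_2pi_int.
Qed.

Lemma normc_ee (x : R) : normc (ee x%:C%C) = 1.
Proof. by rewrite ee_realE normc_cexp expR0. Qed.

Lemma ee_eq1 (x : R) : ee x%:C%C = 1 -> x \is a Num.int.
Proof. by rewrite ee_realE; exact: cexp_2pi_eq1. Qed.

Lemma eeMn (n : nat) z : ee (n%:R * z) = ee z ^+ n.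
Proof.
elim: n => [|n IH]; first by rewrite mul0r ee0.
by rewrite -addn1 natrD mulrDl mul1r eeD IH exprD expr1.
Qed.

Lemma ccont_ee (T : topologicalType) (a : T -> C) :
  ccont a -> ccont (fun t => ee (a t)).
Proof. by move=> ac; apply: ccont_cexp; apply: ccontM => //; exact: ccont_cst. Qed.

Definition dirichlet (m : nat) z := \sum_(j < m) ee z ^+ j.
(** On the reals D_m (- x) is the conjugate of D_m (x), so this is |D_m|^2; without the usual
    division by m its mean is m. *)
Definition fejer (m : nat) z := dirichlet m z * dirichlet m (- z).

Lemma fejerE m z :
  fejer m z = \sum_(j < m) \sum_(k < m) ee ((j%:Z - k%:Z)%:~R * z).
Proof.
rewrite /fejer /dirichlet mulr_suml; apply: eq_bigr => j _.
rewrite mulr_sumr; apply: eq_bigr => k _.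
by rewrite -!eeMn -eeD rmorphB /=; congr ee; rewrite mulrN mulrBl.
Qed.

Lemma fejer_real m (x : R) :
  fejer m x%:C%C = (normc (dirichlet m x%:C%C) ^+ 2)%:C%C.
Proof.
have -> : (normc (dirichlet m x%:C%C) ^+ 2)%:C%C =
    dirichlet m x%:C%C * (dirichlet m x%:C%C)^*%C :> C.
  rewrite normc_sqr; case: (dirichlet m _) => a b.
  by apply: complex_eq; rewrite ?cReM ?cImM /=; ring.
congr (_ * _); rewrite /dirichlet rmorph_sum; apply: eq_bigr => j _.
rewrite rmorphXn /=; congr (_ ^+ _).
rewrite -rmorphN !ee_realE /= expR0 !mul1r mulrN cosN sinN.
by apply: complex_eq => /=; rewrite !mul0r mulr0 subr0 add0r expR0 mul1r.
Qed.

(* The Fejer kernel concentrates at the integers because D_m is a geometric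
   sum. *)
Lemma fejer_concentrates m (x : R) :
  normc (dirichlet m x%:C%C) ^+ 2 * normc (1 - ee x%:C%C) ^+ 2 <= 4.
Proof.
rewrite -exprMn -normcM mulrC /dirichlet -opprB mulNr -subrX1 normcN -eeMn.
have -> : m%:R * x%:C%C = (m%:R * x)%:C%C :> C by rewrite rmorphM rmorph_nat.
have : normc (ee (m%:R * x)%:C%C - 1) <= 2.
  by apply: le_trans (le_normcD _ _) _; rewrite normcN normc_ee normc1.
have := normc_ge0 (ee (m%:R * x)%:C%C - 1); nra.
Qed.

(** A geometric sum with ratio [ee (n / N)]. The bound on |n| excludes aliasing: the ratio is 1 only
    if N divides n. *)
Lemma mean_ee (N : nat) (n : int) : (0 < N)%N -> (`|n| < N)%N ->
  \sum_(a < N) ee (n%:~R * grid R N a) = if n == 0 then N%:R else 0.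
Proof.
move=> N0 nN; case: eqP => [->|/eqP n0].
  under eq_bigr do rewrite mul0r ee0.
  by rewrite sumr_const card_ord.
set x : R := n%:~R / N%:R.
have E (a : nat) : n%:~R * grid R N a = a%:R * x%:C%C.
  rewrite /grid /x !rmorphM /= !rmorph_int rmorph_nat; ring.
under eq_bigr do rewrite E eeMn.
have q1 : ee x%:C%C - 1 != 0.
  rewrite subr_eq0; apply/eqP => /ee_eq1 /intrP [k xk].
  have : n = k * N%:Z.
    apply: (@intr_inj R); rewrite rmorphM /= -xk /x divfK //.
    by rewrite pnatr_eq0 -lt0n.
  move=> nk; move: nN n0; rewrite nk abszM /= mulf_eq0 negb_or -absz_gt0.
  by move=> + /andP[k0 _]; rewrite ltnNge leq_pmull.
apply: (mulfI q1); rewrite -subrX1 mulr0 -eeMn -E /grid divff; last first.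
  by rewrite pnatr_eq0 -lt0n.
by rewrite mulr1 ee_int subrr.
Qed.

(** Only the m diagonal terms j = k survive; m <= N keeps all differences j - k below N in absolute
    value. *)
Lemma fejer_mean (N m : nat) : (0 < N)%N -> (m <= N)%N ->
  \sum_(a < N) fejer m (grid R N a) = (m%:R * N%:R)%:C%C.
Proof.
move=> N0 mN; under eq_bigr do rewrite fejerE.
rewrite exchange_big; under eq_bigr do rewrite exchange_big.
have H (j k : 'I_m) : \sum_(a < N) ee ((j%:Z - k%:Z)%:~R * grid R N a) =
    if k == j then N%:R else 0.
  rewrite mean_ee //; last by have := ltn_ord j; have := ltn_ord k; lia.
  by rewrite subr_eq0 eqz_nat eq_sym.
under eq_bigr do under eq_bigr do rewrite H.
under eq_bigr do rewrite -big_mkcond big_pred1_eq.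
by rewrite sumr_const card_ord rmorphM !rmorph_nat mulr_natl.
Qed.

Section Uniqueness.
Variable F : C -> C -> C.
Hypothesis Fc : cts2 F.
Hypothesis Fper1 : forall z w, F (z + 1) w = F z w.
Hypothesis Fper2 : forall z w, F z (w + 1) = F z w.

Local Notation osc x := (normc (1 - ee x%:C%C) ^+ 2).

(** On the unit square the sum of the two [osc] terms vanishes only at the corners, where [F] takes
    the value F z w by periodicity. Near a corner [eps] suffices, elsewhere a large multiple of the
    positive sum does, and compactness yields a single K. *)
Lemma periodic_oscillation z w (eps : R) : 0 < eps ->
  exists K : R, 0 <= K /\ forall x y : R, 0 <= x <= 1 -> 0 <= y <= 1 ->
    normc (F (z + x%:C%C) (w + y%:C%C) - F z w) <= eps + K * (osc x + osc y).
Proof.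
move=> e0.
pose G (p : R * R) := normc (F (z + p.1%:C%C) (w + p.2%:C%C) - F z w).
pose u (p : R * R) := osc p.1 + osc p.2.
have c1 : ccont (fun p : R * R => p.1%:C%C) by apply: ccont_real; exact: fst_continuous.
have c2 : ccont (fun p : R * R => p.2%:C%C) by apply: ccont_real; exact: snd_continuous.
have Gc : continuous G.
  apply: ccont_normc; apply: ccontD; last exact: ccont_cst.
  by apply: Fc; apply: ccontD => //; exact: ccont_cst.
have oc (a : R * R -> C) : ccont a -> continuous (fun p => normc (1 - ee (a p)) ^+ 2).
  move=> ac; have h : continuous (fun p => normc (1 - ee (a p))).
    apply: ccont_normc; apply: ccontD; first exact: ccont_cst.
    under eq_fun do rewrite -mulN1r.
    by apply: ccontM; [exact: ccont_cst|exact: ccont_ee].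
  by move=> p; under eq_fun do rewrite expr2; apply: cvgM; exact: h.
have uc : continuous u.
  by move=> p; apply: cvgD; apply: oc.
have u0 p : 0 <= u p by rewrite addr_ge0 ?sqr_ge0.
have osc0 x : 0 <= x <= 1 -> osc x = 0 -> x = 0 \/ x = 1.
  move=> /andP[x0 x1] /eqP; rewrite sqrf_eq0 => /eqP /eq0_normc /eqP.
  rewrite subr_eq0 eq_sym => /eqP /ee_eq1 /intrP [n xn].
  have n0 : 0 <= n by rewrite -(ler0z R) -xn.
  have n1 : n <= 1 by rewrite -(ler_int R) -xn.
  rewrite xn.
  have : n = 0 \/ n = 1 by lia.
  by move=> [->|->]; [left|right].
have /compact_near_coveringP Kc :
    compact (`[(0:R), 1] `*` `[(0:R), 1]).
  by apply: compact_setX; exact: segment_compact.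
have := Kc R (pinfty_nbhs R) (fun k p => G p <= eps + k * u p) _.
move=> /(_ _)[|].
  move=> [x y] /= []; rewrite !in_itv /= => hx hy.
  have [uz|un] := eqVneq (u (x, y)) 0.
    have Gz : G (x, y) = 0.
      move/eqP: uz; rewrite paddr_eq0 ?sqr_ge0 //= => /andP[/eqP ox /eqP oy].
      rewrite /G /=; case: (osc0 x hx ox) => ->; case: (osc0 y hy oy) => ->;
        by rewrite ?addr0 ?Fper1 ?Fper2 subrr normc0.
    exists ([set p | G p <= eps], [set k | 0 <= k]) => /=.
      split; last by apply: nbhs_pinfty_ge; rewrite ?num_real.
      have := Gc (x, y); rewrite /continuous_at Gz.
      move=> /cvgr0_norm_le /(_ _ e0); apply: filterS => p.
      by rewrite /= ger0_norm // normc_ge0.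
    move=> [p k] [/= hp k0]; apply: le_trans hp _.
    by rewrite lerDl mulr_ge0.
  have up : 0 < u (x, y) by rewrite lt_def un u0.
  exists ([set p | u (x, y) / 2 <= u p /\ G p <= G (x, y) + 1],
          [set k | (G (x, y) + 1) / (u (x, y) / 2) <= k]) => /=.
    split; last by apply: nbhs_pinfty_ge; rewrite ?num_real.
    apply: filterI.
      by have := uc (x, y); move=> /cvgr_ge; apply; lra.
    by have := Gc (x, y); move=> /cvgr_le; apply; lra.
  move=> [p k] [/= [h1 h2] h3].
  apply: (le_trans h2).
  have : G (x, y) + 1 <= k * (u (x, y) / 2).
    by rewrite -ler_pdivrMr // divr_gt0.
  have k0 : 0 <= k.
    by apply: le_trans h3; rewrite divr_ge0 ?addr_ge0 ?normc_ge0 ?divr_ge0.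
  have := ler_wpM2l k0 h1; lra.
move=> M [Mr HM].
exists (Num.max 0 (M + 1)); split; first by rewrite le_max lexx.
move=> x y hx hy; apply: (HM _ _ (x, y)); last first.
  by split; rewrite /= in_itv.
by rewrite lt_max; apply/orP; right; rewrite ltrDl.
Qed.

Hypothesis coef0 : forall (n m : int) z w, vanishing (fun N =>
  gmean N (fun x y => F x y * ee (n%:~R * x + m%:~R * y)) z w).

(** The product kernel centred at (z, w) is a finite sum of characters [ee (n x + k y)] up to
    constants, and [coef0] applies to each of them. *)
Lemma fejer_mean_vanishes m z w : vanishing (fun N =>
  gmean N (fun x y => F x y * (fejer m (x - z) * fejer m (y - w))) z w).
Proof.
pose W P := vanishing (fun N =>
  gmean N (fun x y => F x y * P (x - z) (y - w)) z w).
have Wsum (n : nat) (P : 'I_n -> C -> C -> C) : (forall i, W (P i)) ->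
    W (fun x y => \sum_(i < n) P i x y).
  move=> HP; apply: vanishing_ext (vanishing_sum HP) _ => N.
  rewrite /gmean -mulr_sumr; congr (_ * _); rewrite -mulr_sumr; congr (_ * _).
  rewrite exchange_big; apply: eq_bigr => b _.
  rewrite exchange_big; apply: eq_bigr => a _.
  by rewrite mulr_sumr.
have We (n k : int) : W (fun x y => ee (n%:~R * x + k%:~R * y)).
  apply: vanishing_ext (vanishingZ (ee (- (n%:~R * z + k%:~R * w))) (coef0 n k z w)) _.
  move=> N; rewrite /gmean mulrCA; congr (_ * _); rewrite mulrCA; congr (_ * _).
  rewrite mulr_sumr; apply: eq_bigr => b _; rewrite mulr_sumr.
  apply: eq_bigr => a _; rewrite mulrCA -eeD; congr (_ * ee _); ring.
suff : W (fun x y => \sum_(j < m) \sum_(k < m) \sum_(j' < m) \sum_(k' < m)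
    ee ((j%:Z - k%:Z)%:~R * x + (j'%:Z - k'%:Z)%:~R * y)).
  congr vanishing; apply/funext => N; congr gmean; apply/funext => x.
  apply/funext => y; congr (_ * _); rewrite !fejerE mulr_suml.
  apply: eq_bigr => j _; rewrite mulr_suml; apply: eq_bigr => k _.
  rewrite mulr_sumr; apply: eq_bigr => j' _; rewrite mulr_sumr.
  by apply: eq_bigr => k' _; rewrite eeD.
apply: (Wsum) => j; apply: (Wsum) => k; apply: (Wsum) => j'.
by apply: (Wsum) => k'; exact: We.
Qed.

(** On the grid the product kernel is nonnegative with mean m^2. Hence |F z w| m^2 is at most the
    kernel mean [S] of [F], which tends to 0, plus the error [T] of replacing [F] by its value at
    (z, w), which is at most eps m^2 + 8 K m by [periodic_oscillation]. *)
Lemma fourier_uniqueness z w : F z w = 0.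
Proof.
apply: eq0_normc; apply/eqP; rewrite eq_le normc_ge0 andbT.
rewrite leNgt; apply/negP => f0; set f := normc (F z w) in f0.
(* Three contributions of size at most eps m^2, one from the kernel mean and two from the error,
   stay below f m^2 = 4 eps m^2. *)
pose eps := f / 4; have e0 : 0 < eps by rewrite divr_gt0.
have [K [K0 HK]] := periodic_oscillation z w e0.
(* This makes 8 K m smaller than eps m^2. The 8 is twice the bound 4 of [fejer_concentrates], once
   for each variable. *)
pose m := (Num.truncn (8 * K / eps)).+1.
have m0 : 0 < m%:R :> R by rewrite ltr0n.
have Km : 8 * K < eps * m%:R.
  by rewrite [ltRHS]mulrC -ltr_pdivrMr // /m Num.Theory.truncnS_gt.
have e1 : 0 < eps * m%:R ^+ 2 by rewrite mulr_gt0 // exprn_gt0.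
have [N [N0 mN]] : exists N : nat, [/\ (0 < N)%N, (m <= N)%N &
    normc (gmean N (fun x y => F x y * (fejer m (x - z) * fejer m (y - w))) z w)
      <= eps * m%:R ^+ 2].
  suff : \forall N \near \oo, [/\ (0 < N)%N, (m <= N)%N &
    normc (gmean N (fun x y => F x y * (fejer m (x - z) * fejer m (y - w))) z w)
      <= eps * m%:R ^+ 2] by move=> /filter_ex.
  near=> N; split; near: N; [by exists 1%N|exact: nbhs_infty_ge|].
  exact: fejer_mean_vanishes.
have n1 : 0 < (N%:R : R)^-1 by rewrite invr_gt0 ltr0n.
pose g a : R := a%:R / N%:R.
pose k a := normc (dirichlet m (g a)%:C%C) ^+ 2.
have kE a : fejer m (grid R N a) = (k a)%:C%C by rewrite /grid fejer_real.
have k0 a : 0 <= k a by exact: sqr_ge0.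
have kmean : \sum_(a < N) k a = m%:R * N%:R.
  apply: complexI; rewrite -fejer_mean // rmorph_sum; apply: eq_bigr => a _.
  by rewrite kE.
have g01 (a : 'I_N) : 0 <= g a <= 1.
  by rewrite divr_ge0 //= ler_pdivrMr ?ltr0n // mul1r ler_nat ltnW.
set S := gmean _ _ _ _ => HS.
pose T := (N%:R^-1)%:C%C * ((N%:R^-1)%:C%C * \sum_(b < N) \sum_(a < N)
  ((F (z + grid R N a) (w + grid R N b) - F z w) * (k a * k b)%:C%C)).
have ST : F z w * (m%:R ^+ 2)%:C%C = S - T.
  have -> : (m%:R ^+ 2)%:C%C = (N%:R^-1)%:C%C * ((N%:R^-1)%:C%C *
     \sum_(b < N) \sum_(a < N) (k a * k b)%:C%C) :> C.
    have -> : \sum_(b < N) \sum_(a < N) (k a * k b)%:C%C =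
        ((m%:R * N%:R) * (m%:R * N%:R))%:C%C :> C.
      rewrite -{2}kmean mulr_sumr rmorph_sum; apply: eq_bigr => b _ /=.
      by rewrite -kmean mulr_suml rmorph_sum.
    rewrite -!rmorphM /=; congr (_ %:C)%C; field.
    by rewrite pnatr_eq0 -lt0n.
  rewrite /S /T /gmean mulrCA -mulrBr; congr (_ * _).
  rewrite mulrCA -mulrBr; congr (_ * _).
  rewrite mulr_sumr -sumrB; apply: eq_bigr => b _.
  rewrite mulr_sumr -sumrB; apply: eq_bigr => a _.
  by rewrite ![_ + _ - _]addrC !addKr !kE -!rmorphM; ring.
have HT : normc T <= eps * m%:R ^+ 2 + 8 * K * m%:R.
  rewrite /T !normcM !normc_real !gtr0_norm // !ler_pdivrMl ?ltr0n //.
  apply: le_trans (normc_sum _ _ _) _.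
  apply: (@le_trans _ _ (\sum_(b < N) \sum_(a < N)
     (eps * (k a * k b) + (4 * K) * k b + (4 * K) * k a))).
    apply: ler_sum => b _; apply: le_trans (normc_sum _ _ _) _.
    apply: ler_sum => a _; rewrite normcM normc_real ger0_norm ?mulr_ge0 ?normc_ge0 //.
    apply: le_trans (ler_wpM2r (mulr_ge0 (k0 a) (k0 b)) (HK _ _ (g01 a) (g01 b))) _.
    have ha : K * (k a * osc (g a)) <= K * 4 by rewrite ler_wpM2l // fejer_concentrates.
    have hb : K * (k b * osc (g b)) <= K * 4 by rewrite ler_wpM2l // fejer_concentrates.
    have := ler_wpM2r (k0 b) ha; have := ler_wpM2r (k0 a) hb; lra.
  have inner (b : nat) : \sum_(a < N)
      (eps * (k a * k b) + (4 * K) * k b + (4 * K) * k a) =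
      (eps * k b + 4 * K) * (m%:R * N%:R) + (4 * K * k b) * N%:R.
    rewrite !big_split /= sumr_const card_ord -!mulr_sumr -mulr_suml kmean.
    by rewrite -mulr_natr; ring.
  under eq_bigr do rewrite inner.
  rewrite big_split /= -!mulr_suml.
  rewrite big_split /= -!mulr_sumr kmean sumr_const card_ord -mulr_natr.
  by rewrite le_eqVlt; apply/orP; left; apply/eqP; ring.
have : f * m%:R ^+ 2 <= eps * m%:R ^+ 2 + (eps * m%:R ^+ 2 + 8 * K * m%:R).
  rewrite -[m%:R ^+ 2 in X in X <= _]ger0_norm ?exprn_ge0 // -normc_real -normcM ST.
  apply: le_trans (le_normcD _ _) _; rewrite normcN; exact: lerD.
have := ler_wpM2r (ltW m0) (ltW Km).
have : 0 < f * m%:R ^+ 2 by rewrite mulr_gt0 // exprn_gt0.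
rewrite /eps; nra.
Unshelve. all: by end_near. Qed.

End Uniqueness.

End FourierUniqueness.

(** * Theta functions *)

Section ThetaFunctions.
Variable R : realType.
Local Notation C := R[i].
Implicit Types (F G D : C -> C -> C) (z w : C).

Definition hol F := [/\ cts2 F, exists D, hol1 F D &
  exists D, hol1 (fun z w => F w z) D].

Lemma cts2_cst (k : C) : cts2 (fun _ _ => k).
Proof. by move=> T a b _ _; exact: ccont_cst. Qed.

Lemma cts2D F G : cts2 F -> cts2 G -> cts2 (fun z w => F z w + G z w).
Proof. by move=> hF hG T a b ha hb; apply: ccontD; [exact: hF|exact: hG]. Qed.

Lemma cts2M F G : cts2 F -> cts2 G -> cts2 (fun z w => F z w * G z w).
Proof. by move=> hF hG T a b ha hb; apply: ccontM; [exact: hF|exact: hG]. Qed.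

Lemma cts2_cexp F : cts2 F -> cts2 (fun z w => cexp (F z w)).
Proof. by move=> hF T a b ha hb; apply: ccont_cexp; exact: hF. Qed.

Lemma cts2_swap F : cts2 F -> cts2 (fun z w => F w z).
Proof. by move=> hF T a b ha hb; exact: hF. Qed.

Lemma hol1_cst (k : C) : hol1 (fun _ _ => k) (fun _ _ => 0).
Proof.
split=> [|z w lam t]; first exact: cts2_cst.
by rewrite mulr0; exact: cderiv_cst.
Qed.

Lemma hol1_fst : hol1 (fun z w => z) (fun _ _ => 1).
Proof.
split=> [|z w lam t]; first exact: cts2_cst.
have := cderivD (cderiv_cst z t) (cderivM (cderiv_real t) (cderiv_cst lam t)).
by rewrite mulr0 addr0 add0r mul1r mulr1.
Qed.

Lemma hol1_snd : hol1 (fun z w => w) (fun _ _ => 0).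
Proof.
split=> [|z w lam t]; first exact: cts2_cst.
by rewrite mulr0; exact: cderiv_cst.
Qed.

Lemma hol1D F G D D' : hol1 F D -> hol1 G D' ->
  hol1 (fun z w => F z w + G z w) (fun z w => D z w + D' z w).
Proof.
move=> [cD hF] [cD' hG]; split=> [|z w lam t]; first exact: cts2D.
by rewrite mulrDr; apply: cderivD.
Qed.

Lemma hol1M F G D D' : cts2 F -> cts2 G -> hol1 F D -> hol1 G D' ->
  hol1 (fun z w => F z w * G z w) (fun z w => D z w * G z w + F z w * D' z w).
Proof.
move=> cF cG [cD hF] [cD' hG]; split=> [|z w lam t].
  by apply: cts2D; exact: cts2M.
by rewrite mulrDr mulrA (mulrCA lam); apply: cderivM.
Qed.

Lemma hol1_cexp F D : cts2 F -> hol1 F D ->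
  hol1 (fun z w => cexp (F z w)) (fun z w => D z w * cexp (F z w)).
Proof.
move=> cF [cD hF]; split=> [|z w lam t]; first by apply: cts2M => //; exact: cts2_cexp.
by rewrite mulrA; apply: (cderiv_cexp (hF z w lam t)).
Qed.

Lemma hol_cst (k : C) : hol (fun _ _ => k).
Proof.
by split; [exact: cts2_cst| |]; exists (fun _ _ => 0); exact: hol1_cst.
Qed.

Lemma hol_fst : hol (fun z w => z).
Proof.
split; first by move=> T a b.
  by exists (fun _ _ => 1); exact: hol1_fst.
by exists (fun _ _ => 0); exact: hol1_snd.
Qed.

Lemma hol_snd : hol (fun z w => w).
Proof.
split; first by move=> T a b.
  by exists (fun _ _ => 0); exact: hol1_snd.
by exists (fun _ _ => 1); exact: hol1_fst.
Qed.

Lemma holD F G : hol F -> hol G -> hol (fun z w => F z w + G z w).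
Proof.
move=> [cF [D hD] [D' hD']] [cG [E hE] [E' hE']]; split; first exact: cts2D.
  by eexists; exact: (hol1D hD hE).
by eexists; exact: (hol1D hD' hE').
Qed.

Lemma holM F G : hol F -> hol G -> hol (fun z w => F z w * G z w).
Proof.
move=> [cF [D hD] [D' hD']] [cG [E hE] [E' hE']]; split; first exact: cts2M.
  by eexists; exact: (hol1M cF cG hD hE).
by eexists; exact: (hol1M (cts2_swap cF) (cts2_swap cG) hD' hE').
Qed.

Lemma hol_cexp F : hol F -> hol (fun z w => cexp (F z w)).
Proof.
move=> [cF [D hD] [D' hD']]; split; first exact: cts2_cexp.
  by eexists; exact: (hol1_cexp cF hD).
by eexists; exact: (hol1_cexp (cts2_swap cF) hD').
Qed.

Lemma gmean_translate2 F z w lam mu : hol F ->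
  (forall z w, F (z + 1) w = F z w) -> (forall z w, F z (w + 1) = F z w) ->
  vanishing (fun N => gmean N F (z + lam) (w + mu) - gmean N F z w).
Proof.
move=> [_ [D hD] [D' hD']] p1 p2.
have h1 := gmean_translate hD p1 z (w + mu) lam.
have h2 := gmean_translate hD' (fun z w => p2 w z) w z mu.
apply: vanishing_ext (vanishingD h1 h2) _ => N.
by rewrite -!(gmean_swap N F) addrA subrK.
Qed.

(** The map a -> N - a permutes the grid modulo 1; the fixed term a = 0 is split off. *)
Lemma sum_grid_opp N (f : C -> C) : (forall x, f (x + 1) = f x) ->
  \sum_(a < N) f (- grid R N a) = \sum_(a < N) f (grid R N a).
Proof.
move=> fper; case: N => [|n]; first by rewrite !big_ord0.
rewrite !big_ord_recl /= /grid mul0r oppr0; congr (_ + _).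
rewrite (reindex_inj rev_ord_inj); apply: eq_bigr => i _.
rewrite -fper /=; congr f; rewrite /bump /= !add1n subnSK //.
rewrite -(rmorph1 (real_complex R)) -rmorphN -rmorphD /=; congr (_ %:C)%C.
apply: (@mulIf _ n.+1%:R); first by rewrite pnatr_eq0.
rewrite mulrDl mulNr !divfK ?pnatr_eq0 // mul1r natrB; last exact: ltnW.
by rewrite -[n.+1]addn1 -[i.+1]addn1 !natrD; ring.
Qed.

Lemma gmean_opp N F z w :
  (forall z w, F (z + 1) w = F z w) -> (forall z w, F z (w + 1) = F z w) ->
  gmean N F (- z) (- w) = gmean N (fun x y => F (- x) (- y)) z w.
Proof.
move=> p1 p2; rewrite /gmean; congr (_ * (_ * _)).
rewrite -(@sum_grid_opp N (fun y => \sum_(a < N) F (- z + grid R N a) (- w + y))).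
  apply: eq_bigr => b _.
  rewrite -(@sum_grid_opp N (fun x => F (- z + x) _)).
    by apply: eq_bigr => a _; rewrite !opprD.
  by move=> x; rewrite addrA p1.
by move=> y; apply: eq_bigr => a _; rewrite addrA p2.
Qed.

(* A translation by tau_j shifts the Fourier coefficients by one step in the
   j-th direction, so that all of them are determined by the zeroth one, which
   vanishes for an odd function. *)
Lemma odd_theta_zero F (t11 t12 t21 t22 k1 k2 : C) : hol F ->
  (forall z w, F (z + 1) w = F z w) -> (forall z w, F z (w + 1) = F z w) ->
  k1 != 0 -> k2 != 0 ->
  (forall z w, F (z + t11) (w + t12) = k1 * ee z * F z w) ->
  (forall z w, F (z + t21) (w + t22) = k2 * ee w * F z w) ->
  (forall z w, F (- z) (- w) = - F z w) ->
  forall z w, F z w = 0.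
Proof.
move=> hF p1 p2 k10 k20 q1 q2 odd.
pose phi (n m : int) z w := F z w * ee (n%:~R * z + m%:~R * w).
have hphi n m : hol (phi n m).
  apply: holM => //; apply: hol_cexp; apply: holM; first exact: hol_cst.
  apply: holD; apply: holM; [exact: hol_cst|exact: hol_fst|exact: hol_cst|].
  exact: hol_snd.
have per1 n m z w : phi n m (z + 1) w = phi n m z w.
  by rewrite /phi p1 mulrDr mulr1 addrAC eeD ee_int mulr1.
have per2 n m z w : phi n m z (w + 1) = phi n m z w.
  by rewrite /phi p2 mulrDr mulr1 addrA eeD ee_int mulr1.
have gshift N n m n' m' t t' c z w :
    (forall x y, phi n m (x + t) (y + t') = c * phi n' m' x y) ->
    gmean N (phi n m) (z + t) (w + t') = c * gmean N (phi n' m') z w.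
  move=> H; rewrite /gmean [RHS]mulrCA; congr (_ * _).
  rewrite [RHS]mulrCA; congr (_ * _).
  rewrite mulr_sumr; apply: eq_bigr => b _; rewrite mulr_sumr.
  by apply: eq_bigr => a _; rewrite -H !(addrAC _ _ (grid _ _ _)).
pose A n m := forall z w, vanishing (fun N => gmean N (phi n m) z w).
(* From left to right the base point is merely moved, which is exact; the converse needs the
   asymptotic translation invariance of the means. *)
have step n m n' m' t t' c : c != 0 ->
    (forall x y, phi n m (x + t) (y + t') = c * phi n' m' x y) ->
    A n m <-> A n' m'.
  move=> c0 H; split=> HA z w.
    have := vanishingZ c^-1 (HA (z + t) (w + t')).
    by move/vanishing_ext; apply => N; rewrite (gshift _ _ _ _ _ _ _ _ _ _ H) mulKf.
  have h1 := vanishingN (gmean_translate2 z w t t' (hphi n m) (per1 n m) (per2 n m)).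
  have h2 := vanishingZ c (HA z w).
  apply: vanishing_ext (vanishingD h1 h2) _ => N.
  by rewrite (gshift _ _ _ _ _ _ _ _ _ _ H) opprB subrK.
have st1 n m : A n m <-> A (n + 1) m.
  apply: (step _ _ _ _ t11 t12 (k1 * ee (n%:~R * t11 + m%:~R * t12))).
    by rewrite mulf_neq0 // cexp_neq0.
  move=> x y; rewrite /phi q1.
  have -> : n%:~R * (x + t11) + m%:~R * (y + t12) =
    (n%:~R * x + m%:~R * y) + (n%:~R * t11 + m%:~R * t12) :> C by ring.
  have -> : (n + 1)%:~R * x + m%:~R * y = x + (n%:~R * x + m%:~R * y) :> C.
    by rewrite rmorphD /=; ring.
  by rewrite !(eeD (_ + _)) (eeD x); ring.
have st2 n m : A n m <-> A n (m + 1).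
  apply: (step _ _ _ _ t21 t22 (k2 * ee (n%:~R * t21 + m%:~R * t22))).
    by rewrite mulf_neq0 // cexp_neq0.
  move=> x y; rewrite /phi q2.
  have -> : n%:~R * (x + t21) + m%:~R * (y + t22) =
    (n%:~R * x + m%:~R * y) + (n%:~R * t21 + m%:~R * t22) :> C by ring.
  have -> : n%:~R * x + (m + 1)%:~R * y = y + (n%:~R * x + m%:~R * y) :> C.
    by rewrite rmorphD /=; ring.
  by rewrite !(eeD (_ + _)) (eeD y); ring.
have A00 : A 0 0.
  move=> z w; have P0 : phi 0 0 = F.
    by apply/funext => x; apply/funext => y; rewrite /phi !mul0r addr0 ee0 mulr1.
  rewrite P0.
  (* By oddness the translation from (z, w) to (- z, - w) turns the mean into its opposite, so the
     vanishing difference is - 2 times the mean. *)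
  have := vanishingZ (- (2^-1)) (gmean_translate2 z w (- z - z) (- w - w) hF p1 p2).
  move/vanishing_ext; apply => N; rewrite !addrA !subrr !sub0r gmean_opp //.
  have -> : gmean N (fun x y => F (- x) (- y)) z w = - gmean N F z w.
    rewrite /gmean -!mulrN; congr (_ * (_ * _)).
    by rewrite -sumrN; apply: eq_bigr => b _; rewrite -sumrN; apply: eq_bigr.
  by field.
have An0 n : A n 0.
  elim/int_rect: n => [//|n IH|n IH].
    by rewrite -addn1 PoszD; exact: (st1 _ _).1.
  by apply: (st1 _ _).2; rewrite -addn1 PoszD opprD subrK.
have Anm n m : A n m.
  elim/int_rect: m => [//|m IH|m IH].
    by rewrite -addn1 PoszD; exact: (st2 _ _).1.
  by apply: (st2 _ _).2; rewrite -addn1 PoszD opprD subrK.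
move=> z w; apply: fourier_uniqueness => //; first by case: hF.
Qed.

End ThetaFunctions.

(** * Holomorphic functions on V in complex coordinates *)

Section Holomorphic.
Variable R : realType.
Local Notation C := R[i].
Local Notation V := 'rV[R[i]^o]_2.

Lemma complex_normE (z : R[i]^o) : `|z| = (normc z)%:C%C.
Proof. by []. Qed.

Lemma cvg_Re (T : Type) (F : set_system T) (FF : Filter F) (a : T -> R[i]^o) (l : R[i]^o) :
  a @ F --> l -> Re (a x) @[x --> F] --> Re l.
Proof.
move=> /cvgrPdist_lt h; apply/cvgrPdist_lt => e e0; have := h e%:C%C.
rewrite ltcR => /(_ e0); apply: filterS => s; rewrite complex_normE ltcR.
by apply: le_lt_trans; rewrite -cReN -cReD Re_normc.
Qed.

Lemma cvg_Im (T : Type) (F : set_system T) (FF : Filter F) (a : T -> R[i]^o) (l : R[i]^o) :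
  a @ F --> l -> Im (a x) @[x --> F] --> Im l.
Proof.
move=> /cvgrPdist_lt h; apply/cvgrPdist_lt => e e0; have := h e%:C%C.
rewrite ltcR => /(_ e0); apply: filterS => s; rewrite complex_normE ltcR.
by apply: le_lt_trans; rewrite -cImN -cImD Im_normc.
Qed.

Lemma ccont_continuous (T : topologicalType) (a : T -> C) :
  ccont a <-> continuous (a : T -> R[i]^o).
Proof.
split=> [[h1 h2] t|h].
  apply/cvgrPdist_lt => -[e f] /=; rewrite ltcE /= => /andP[/eqP -> e0].
  have e2 : 0 < e / 2 by lra.
  have {}h1 := (cvgrPdist_lt _ _).1 (h1 t) _ e2.
  have {}h2 := (cvgrPdist_lt _ _).1 (h2 t) _ e2.
  near=> s; rewrite complex_normE ltcR.
  apply: le_lt_trans (normc_le _) _; rewrite (splitr e).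
  by rewrite cReD cImD cReN cImN; apply: ltrD; near: s; [exact: h1|exact: h2].
by split=> t; [exact: cvg_Re (h t)|exact: cvg_Im (h t)].
Unshelve. all: by end_near. Qed.

Lemma real_complex_dnbhs :
  (fun h : R => h%:C%C : R[i]^o) @ 0^' --> (0 : R[i]^o)^'.
Proof.
move=> A [/= e e0 HA].
have e1 : 0 < Re e by move: e0; rewrite /= ltcE /= => /andP[].
exists (Re e) => //= h; rewrite /= sub0r normrN => he h0.
apply: HA; last by apply/eqP => /complexI /eqP; rewrite (negbTE h0).
rewrite /= sub0r normrN complex_normE normc_real.
by move: e0; rewrite !ltcE /= => /andP[/eqP -> _]; rewrite eqxx.
Qed.

Lemma derivable_cvg (f : V -> R[i]^o) (p u : V) : derivable f p u ->
  (fun h : R => (h%:C%C)^-1 *: (f (h%:C%C *: u + p) - f p) : R[i]^o) @ 0^'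
    --> ('D_u f p : R[i]^o).
Proof. by move=> df; exact: cvg_comp real_complex_dnbhs df. Qed.

Lemma derivable_cderiv (f : V -> R[i]^o) (p u : V) (t : R) :
  derivable f (p + t%:C%C *: u) u ->
  cderiv (fun s => f (p + s%:C%C *: u)) t ('D_u f (p + t%:C%C *: u)).
Proof.
move=> /derivable_cvg; set L := 'D_u f _ => H.
have E (h : R) : p + (h + t)%:C%C *: u = h%:C%C *: u + (p + t%:C%C *: u).
  by rewrite rmorphD /= scalerDl addrCA.
have ReZ (h : R) (x : C) : Re ((h%:C%C)^-1 * x) = h^-1 * Re x.
  by rewrite -fmorphV cReM /= mul0r subr0.
have ImZ (h : R) (x : C) : Im ((h%:C%C)^-1 * x) = h^-1 * Im x.
  by rewrite -fmorphV cImM /= mul0r addr0.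
have der (g : R -> R) l : (h^-1 * (g (h + t) - g t) @[h --> 0^'] --> l) ->
    is_derive t 1 g l.
  move=> Hl; have Hl' : h^-1 *: ((g \o shift t) (h *: 1) - g t) @[h --> 0^'] --> l.
    by apply: cvg_trans Hl; apply: near_eq_cvg; near=> h;
      rewrite /= [h *: 1]mulr1.
  apply: DeriveDef; first by apply/cvg_ex; exists l.
  exact: cvg_lim Hl'.
split; apply: der.
  apply: cvg_trans (cvg_Re _ H); apply: near_eq_cvg; near=> h.
  by rewrite E /GRing.scale /= ReZ cReD cReN.
apply: cvg_trans (cvg_Im _ H); apply: near_eq_cvg; near=> h.
by rewrite E /GRing.scale /= ImZ cImD cImN.
Unshelve. all: by end_near. Qed.

Lemma derive_scale (f : V -> R[i]^o) (p u : V) (k : C) :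
  differentiable f p -> 'D_(k *: u) f p = k * 'D_u f p.
Proof. by move=> df; rewrite !deriveE // linearZ. Qed.

(** Passage from differentiability over [R[i]] to the calculus in two variables. C-linearity of the
    differential extracts the factor [lam] from the direction, and the second half of
    [holomorphic_on] makes the partial derivatives continuous. *)
Lemma hol_holomorphic (theta : V -> C) (e1 e2 : V) : holomorphic theta ->
  hol (fun z w => theta (z *: e1 + w *: e2)).
Proof.
move=> hth.
have line (T : topologicalType) (a b : T -> C) : ccont a -> ccont b ->
    continuous (fun t => a t *: e1 + b t *: e2 : V).
  move=> /ccont_continuous ha /ccont_continuous hb t.
  by apply: cvgD; apply: cvgZl; [exact: ha|exact: hb].
have cts (g : V -> R[i]^o) : continuous g ->
    cts2 (fun z w => g (z *: e1 + w *: e2)).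
  move=> gc T a b ha hb; apply/ccont_continuous.
  exact: continuous_compose gc (line _ _ _ ha hb).
have dth v : differentiable (theta : V -> R[i]^o) v by have [] := hth v I.
have main (u v : V) z w lam t :
    cderiv (fun s => theta ((z + s%:C%C * lam) *: u + w *: v)) t
      (lam * 'D_u (theta : V -> R[i]^o) ((z + t%:C%C * lam) *: u + w *: v)).
  have E s : (z + s%:C%C * lam) *: u + w *: v =
      (z *: u + w *: v) + s%:C%C *: (lam *: u).
    by rewrite scalerDl scalerA addrAC.
  rewrite -derive_scale // E.
  under eq_fun do rewrite E.
  by apply: derivable_cderiv; apply: diff_derivable.
split.
- by apply: cts => v; exact: differentiable_continuous.
- exists (fun z w => 'D_e1 (theta : V -> R[i]^o) (z *: e1 + w *: e2)).
  split; first by apply: (cts ('D_e1 (theta : V -> R[i]^o))) => v; exact: (hth v I).2.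
  by move=> z w lam t; exact: main.
- exists (fun w z => 'D_e2 (theta : V -> R[i]^o) (z *: e1 + w *: e2)).
  split.
    apply: (@cts2_swap _ (fun z w => 'D_e2 (theta : V -> R[i]^o) (z *: e1 + w *: e2))).
    by apply: (cts ('D_e2 (theta : V -> R[i]^o))) => v; exact: (hth v I).2.
  move=> w z lam t; rewrite addrC.
  by under eq_fun do rewrite addrC; exact: main.
Qed.

End Holomorphic.

(** * Polarizations *)

Section Polarization.
Variable R : realType.
Local Notation C := R[i].
Local Notation V := 'rV[R[i]^o]_2.
Variables (Lam : set V) (E : V -> V -> R).
Hypothesis pol : polarization Lam E.

Lemma realZ1 (v : V) : (1 : R)%:C%C *: v = v.
Proof. by rewrite (_ : (1 : R)%:C%C = 1 :> C) // scale1r. Qed.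

Lemma polDl u v w : E (u + v) w = E u w + E v w.
Proof. by have := pol_linearl pol 1 u v w; rewrite realZ1 mul1r. Qed.

Lemma polDr u v w : E w (u + v) = E w u + E w v.
Proof. by have := pol_linearr pol 1 u v w; rewrite realZ1 mul1r. Qed.

Lemma pol0l w : E 0 w = 0.
Proof. by have := polDl 0 0 w; rewrite addr0; lra. Qed.

Lemma pol0r w : E w 0 = 0.
Proof. by have := polDr 0 0 w; rewrite addr0; lra. Qed.

Lemma polZl (a : R) u w : E (a%:C%C *: u) w = a * E u w.
Proof. by have := pol_linearl pol a u 0 w; rewrite addr0 pol0l addr0. Qed.

Lemma polZr (a : R) u w : E w (a%:C%C *: u) = a * E w u.
Proof. by have := pol_linearr pol a u 0 w; rewrite addr0 pol0r addr0. Qed.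

Lemma polNl u w : E (- u) w = - E u w.
Proof. by have := polDl u (- u) w; rewrite subrr pol0l; lra. Qed.

Lemma polNr u w : E w (- u) = - E w u.
Proof. by have := polDr u (- u) w; rewrite subrr pol0r; lra. Qed.

Lemma polC u v : E u v = - E v u.
Proof.
have := pol_alternating pol (u + v).
by rewrite polDl !polDr !(pol_alternating pol); lra.
Qed.

Lemma polMnl u v n : E (u *+ n) v = E u v *+ n.
Proof.
elim: n => [|n IH]; first by rewrite !mulr0n pol0l.
by rewrite !mulrS polDl IH.
Qed.

Lemma polMzl u v (n : int) : E (u *~ n) v = n%:~R * E u v.
Proof.
case: n => n; first by rewrite -pmulrn polMnl mulr_natl.
by rewrite NegzE mulrNz polNl -pmulrn polMnl mulrNz mulNr mulr_natl.
Qed.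

Lemma polMzr u v (n : int) : E u (v *~ n) = n%:~R * E u v.
Proof. by rewrite polC polMzl (polC u v) mulrN. Qed.

Lemma scalei2 (v : V) : 'i%C *: ('i%C *: v) = - v.
Proof. by rewrite scalerA -expr2 sqr_i scaleN1r. Qed.

Lemma pol_iC u v : E ('i%C *: u) v = E ('i%C *: v) u.
Proof.
by rewrite -(pol_hermitian pol) scalei2 polNl polC opprK.
Qed.

Lemma complex_scale (c : C) (u : V) :
  c *: u = (Re c)%:C%C *: u + (Im c)%:C%C *: ('i%C *: u).
Proof. by rewrite scalerA -scalerDl {1}[c]complexE mulrC. Qed.

Lemma hermDl u v w : herm E (u + v) w = herm E u w + herm E v w.
Proof. by rewrite /herm scalerDr !polDl. Qed.

Lemma hermDr u v w : herm E w (u + v) = herm E w u + herm E w v.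
Proof. by rewrite /herm !polDr. Qed.

Lemma hermNN u v : herm E (- u) (- v) = herm E u v.
Proof. by rewrite /herm scalerN !polNl !polNr !opprK. Qed.

Lemma hermZl (c : C) u v : herm E (c *: u) v = c * herm E u v.
Proof.
have H (a b : R) : E (a%:C%C *: u + b%:C%C *: ('i%C *: u)) v =
    a * E u v + b * E ('i%C *: u) v by rewrite polDl !polZl.
have H' (a b : R) : 'i%C *: (a%:C%C *: u + b%:C%C *: ('i%C *: u)) =
    (- b)%:C%C *: u + a%:C%C *: ('i%C *: u).
  rewrite scalerDr !scalerA addrC; congr (_ *: _ + _ *: _).
    by apply: complex_eq; rewrite !(cReM, cImM) /=; ring.
  by rewrite mulrC.
rewrite complex_scale /herm H' !H.
by apply: complex_eq; rewrite ?cReM ?cImM /=; ring.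
Qed.

Lemma hermC u v : herm E u v - herm E v u = (0 +i* (2 * E u v))%C.
Proof.
rewrite /herm pol_iC (polC v u).
by apply: complex_eq; rewrite ?cReD ?cImD ?cReN ?cImN /=; ring.
Qed.

Lemma herm_sym u v : E u v = 0 -> herm E u v = herm E v u.
Proof.
move=> h; apply/eqP; rewrite -subr_eq0 hermC h mulr0.
by apply/eqP; apply: complex_eq.
Qed.

Lemma pol_definite v : E ('i%C *: v) v = 0 -> v = 0.
Proof.
by move=> h; apply: contraPeq h => /(pol_positive pol); rewrite lt_def => /andP[/eqP].
Qed.

Section Basis.
Variables (e1 e2 : V).
Hypothesis e12 : E e1 e2 = 0.
Hypothesis indep : forall a b : R, a%:C%C *: e1 + b%:C%C *: e2 = 0 -> a = 0 /\ b = 0.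

Lemma span_isotropic (a b a' b' : R) :
  E (a%:C%C *: e1 + b%:C%C *: e2) (a'%:C%C *: e1 + b'%:C%C *: e2) = 0.
Proof.
by rewrite !polDl !polDr !polZl !polZr !(pol_alternating pol) (polC e2) e12; ring.
Qed.

(* A real subspace W on which E vanishes satisfies W /\ iW = 0, as E(iw, w) > 0
   for w != 0; so a real basis of W is complex-independent. *)
Lemma isotropic_free (z w : C) : z *: e1 + w *: e2 = 0 -> z = 0 /\ w = 0.
Proof.
have S (a : R) (u : V) : a%:C%C *: ('i%C *: u) = 'i%C *: (a%:C%C *: u).
  by rewrite !scalerA mulrC.
rewrite (complex_scale z) (complex_scale w) addrACA !S -scalerDr.
set x : V := (Re z)%:C%C *: e1 + _; set y : V := (Im z)%:C%C *: e1 + _ => h.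
have y0 : y = 0.
  apply: pol_definite; rewrite (_ : 'i%C *: y = - x) ?polNl.
    by rewrite span_isotropic oppr0.
  by apply/eqP; rewrite -addr_eq0 addrC h.
have x0 : x = 0 by move: h; rewrite y0 scaler0 addr0.
have [z1 w1] := indep x0; have [z2 w2] := indep y0.
by split; apply: complex_eq.
Qed.

Lemma isotropic_span (v : V) : exists z w : C, v = z *: e1 + w *: e2.
Proof.
pose M : 'M[C]_2 := \matrix_(i, j) (if i == ord0 then e1 0 j else e2 0 j).
have mulM (u : 'rV[C]_2) : u *m M = u 0 0 *: e1 + u 0 1 *: e2 :> V.
  apply/rowP => j; rewrite !mxE !big_ord_recl big_ord0 !mxE addr0 /=.
  by congr (_ * _ + _ * _); congr (u _ _); apply: val_inj.
have Mu : M \in unitmx.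
  rewrite -row_free_unit; apply: inj_row_free => u.
  rewrite mulM => /isotropic_free [h0 h1]; apply/rowP => j; rewrite mxE.
  have [->|->] : j = 0 \/ j = 1; last by [].
    by case: j => [[|[|]]] // jj; [left|right]; apply: val_inj.
  by [].
exists ((v *m invmx M) 0 0), ((v *m invmx M) 0 1).
by rewrite -mulM mulmxKV.
Qed.

End Basis.

End Polarization.

(** * Evenness of theta functions *)

Section ThetaParity.
Variable R : realType.
Local Notation C := R[i].
Local Notation V := 'rV[R[i]^o]_2.
Variables (Lam : set V) (E : V -> V -> R).
Hypothesis pol : polarization Lam E.
Implicit Types (l v : V).

(** The canonical factor with its semicharacter removed; the two agree on Lam' /\ V1 and on Lam' /\
    V2, where [chi0] is 1. *)
Definition gauss_factor l v : C :=
  cexp ((pi)%:C%C * herm E v l + (pi / 2)%:C%C * herm E l l).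

Lemma gauss_factorNN l v : gauss_factor (- l) (- v) = gauss_factor l v.
Proof. by rewrite /gauss_factor !(hermNN pol). Qed.

Section Quasiperiod.
Variables (e1 e2 : V) (phi : V -> C).
Hypothesis e12 : E e1 e2 = 0.

Let Q (z w : C) : C := herm E e1 e1 * (z * z) + 2 * herm E e1 e2 * (z * w) +
  herm E e2 e2 * (w * w).

(* Dividing by the exponential of the quadratic form that extends H complex
   bilinearly from the real span of e1 and e2 makes a section periodic. *)
Definition classical_theta (z w : C) : C :=
  cexp ((- (pi / 2))%:C%C * Q z w) * phi (z *: e1 + w *: e2).

(** If B is the bilinear extension, H (v, l) - B (v, l) is C-linear in v with value 2 i E (e_j, l)
    at e_j, which produces the character [ee]. The remaining H (l, l) - B (l, l) is constant in
    v. *)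
Lemma classical_quasiperiod l (t1 t2 z w : C) : l = t1 *: e1 + t2 *: e2 ->
  (forall v, phi (v + l) = gauss_factor l v * phi v) ->
  classical_theta (z + t1) (w + t2) =
    cexp ((pi / 2)%:C%C * (herm E l l - (t1 * herm E l e1 + t2 * herm E l e2))) *
    ee (z * (E e1 l)%:C%C + w * (E e2 l)%:C%C) * classical_theta z w.
Proof.
move=> lE hphi; rewrite /classical_theta.
have -> : (z + t1) *: e1 + (w + t2) *: e2 = (z *: e1 + w *: e2) + l.
  by rewrite lE !scalerDl addrACA.
rewrite hphi /gauss_factor /ee !mulrA -!cexpD; congr (cexp _ * _).
have H1 : herm E l e1 = t1 * herm E e1 e1 + t2 * herm E e1 e2.
  by rewrite lE (hermDl pol) !(hermZl pol) (herm_sym pol e12).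
have H2 : herm E l e2 = t1 * herm E e1 e2 + t2 * herm E e2 e2.
  by rewrite lE (hermDl pol) !(hermZl pol).
have G1 : herm E e1 l = herm E l e1 + (0 +i* (2 * E e1 l))%C.
  by rewrite -(hermC pol); ring.
have G2 : herm E e2 l = herm E l e2 + (0 +i* (2 * E e2 l))%C.
  by rewrite -(hermC pol); ring.
rewrite (hermDl pol) !(hermZl pol) G1 G2.
have im (x : R) : (0 +i* (2 * x))%C = 2 * (0 +i* 1)%C * x%:C%C :> C.
  by apply: complex_eq; rewrite ?(cReM, cImM) /=; ring.
have pi2 : (0 +i* (pi * 2))%C = 2 * (0 +i* 1)%C * (pi)%:C%C :> C.
  by apply: complex_eq; rewrite ?(cReM, cImM) /=; ring.
have half_pi : (pi)%:C%C = 2 * (pi / 2)%:C%C :> C.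
  by rewrite -(rmorph_nat (real_complex R) 2) -rmorphM; congr (_%:C)%C; field.
rewrite !im pi2 rmorphN half_pi H1 H2 /Q.
by ring.
Qed.

End Quasiperiod.

(** [odd_theta_zero] kills the odd function [phi], which has the quasi-periods of theta because
    [gauss_factor] is unchanged when both arguments change sign. In the coordinates of [e1] and [e2]
    these two become periods 1, while E (e_i, f_j) = delta_ij gives [f1] and [f2] the multipliers
    [ee z] and [ee w] up to constants. *)
Lemma theta_even (theta : V -> C) (e1 e2 f1 f2 : V) :
  holomorphic theta ->
  E e1 e2 = 0 -> E f1 f2 = 0 ->
  E e1 f1 = 1 -> E e2 f2 = 1 -> E e1 f2 = 0 -> E e2 f1 = 0 ->
  (forall l, l \in [:: e1; e2; f1; f2] -> forall v,
     theta (v + l) = gauss_factor l v * theta v /\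
     theta (v - l) = gauss_factor (- l) v * theta v) ->
  forall v, theta (- v) = theta v.
Proof.
move=> hth e12 f12 e1f1 e2f2 e1f2 e2f1 hper.
pose phi v := theta v - theta (- v).
have phiper l : l \in [:: e1; e2; f1; f2] ->
    forall v, phi (v + l) = gauss_factor l v * phi v.
  move=> hl v; rewrite /phi (hper l hl v).1 opprD (hper l hl (- v)).2.
  by rewrite gauss_factorNN mulrBr.
have indep (a b : R) : a%:C%C *: e1 + b%:C%C *: e2 = 0 -> a = 0 /\ b = 0.
  move=> h; have h1 := pol0l pol f1; have h2 := pol0l pol f2.
  move: h1 h2; rewrite -h !(polDl pol) !(polZl pol) e1f1 e2f2 e1f2 e2f1.
  by split; lra.
pose psi := classical_theta e1 e2 phi.
have hpsi : hol psi.
  apply: holM.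
    apply: hol_cexp; apply: holM; first exact: hol_cst.
    apply: holD; first apply: holD; apply: holM; do ?exact: hol_cst.
    - by apply: holM; exact: hol_fst.
    - by apply: holM; [exact: hol_fst|exact: hol_snd].
    - by apply: holM; exact: hol_snd.
  have := holD (hol_holomorphic e1 e2 hth)
    (holM (hol_cst (-1)) (hol_holomorphic (- e1) (- e2) hth)).
  congr hol; apply/funext => z; apply/funext => w.
  by rewrite /phi mulN1r !scalerN -opprD.
have [t11 [t12 f1E]] := isotropic_span pol e12 indep f1.
have [t21 [t22 f2E]] := isotropic_span pol e12 indep f2.
have mem x : x \in [:: e1; e2; f1; f2] = [|| x == e1, x == e2, x == f1 | x == f2].
  by rewrite !inE.
have p1 z w : psi (z + 1) w = psi z w.
  rewrite -[w in LHS]addr0 /psi.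
  rewrite (@classical_quasiperiod e1 e2 phi e12 e1) ?scale1r ?scale0r ?addr0 //;
    last by apply: phiper; rewrite mem eqxx.
  rewrite (pol_alternating pol) (polC pol e2) e12 oppr0 !mulr0 addr0 ee0.
  by rewrite mul0r mul1r addr0 subrr mulr0 cexp0 !mul1r.
have p2 z w : psi z (w + 1) = psi z w.
  rewrite -[z in LHS]addr0 /psi.
  rewrite (@classical_quasiperiod e1 e2 phi e12 e2) ?scale1r ?scale0r ?add0r //;
    last by apply: phiper; rewrite mem eqxx !orbT.
  rewrite (pol_alternating pol) e12 !mulr0 addr0 ee0.
  by rewrite mul0r mul1r add0r subrr mulr0 cexp0 !mul1r.
have q1 := classical_quasiperiod e12 _ _ f1E (phiper f1 _).
have q2 := classical_quasiperiod e12 _ _ f2E (phiper f2 _).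
have psi0 : forall z w, psi z w = 0.
  apply: (@odd_theta_zero _ psi t11 t12 t21 t22 _ _ hpsi p1 p2
    (cexp_neq0 _) (cexp_neq0 _)).
  - move=> z w; rewrite /psi q1; last by rewrite mem eqxx !orbT.
    by rewrite e1f1 e2f1 mulr0 addr0 mulr1.
  - move=> z w; rewrite /psi q2; last by rewrite mem eqxx !orbT.
    by rewrite e1f2 e2f2 mulr0 add0r mulr1.
  - move=> z w; rewrite /psi /classical_theta !mulrNN !scaleNr -opprD.
    have -> u : phi (- u) = - phi u by rewrite /phi opprK opprB.
    by rewrite mulrN.
move=> v; have [z [w vE]] := isotropic_span pol e12 indep v.
have /eqP := psi0 z w; rewrite mulf_eq0 (negbTE (cexp_neq0 _)) /= -vE.
by rewrite subr_eq0 => /eqP ->.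
Qed.

End ThetaParity.

(** * Values of an even theta function at half periods *)

Section HalfPeriods.
Variable R : realType.
Local Notation C := R[i].
Local Notation V := 'rV[R[i]^o]_2.
Variables (Lam : set V) (E : V -> V -> R).
Hypothesis pol : polarization Lam E.
Variable theta : V -> C.
Hypothesis theta_hol : holomorphic theta.
Hypothesis theta_sym : forall v, theta (- v) = theta v.

Lemma cderiv_unique (f : R -> C) t k l : cderiv f t k -> cderiv f t l -> k = l.
Proof.
by move=> [[_ h1] [_ h2]] [[_ h3] [_ h4]]; apply: complex_eq; rewrite -?h1 -?h2.
Qed.

(** The period u + u carries - u to u. At - u the terms - 2 pi H (u, u) and 2 pi H (u, u) of the
    exponent cancel; [s] measures the departure from - u along [w]. *)
Lemma gauss_factor_half (u w : V) (s : C) :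
  gauss_factor E (u + u) (- u + s *: w) = cexp (s * ((pi)%:C%C * herm E w (u + u))).
Proof.
rewrite /gauss_factor; congr cexp.
rewrite !(hermDl pol) (hermZl pol) !(hermDr pol).
have -> : herm E (- u) u = - herm E u u.
  by rewrite -scaleN1r (hermZl pol) mulN1r.
have -> : (pi)%:C%C = 2 * (pi / 2)%:C%C :> C.
  by rewrite -(rmorph_nat (real_complex R) 2) -rmorphM; congr (_%:C)%C; field.
by ring.
Qed.

(** At v = - u the factor is 1, and evenness turns the relation into theta u = - theta u. *)
Lemma odd_half_period (u : V) :
  (forall v, theta (v + (u + u)) = - gauss_factor E (u + u) v * theta v) ->
  theta u = 0.
Proof.
move=> /(_ (- u)); rewrite addrA addNr add0r theta_sym.
have := gauss_factor_half u 0 0; rewrite scaler0 addr0 mul0r cexp0 => ->.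
by rewrite mulN1r => /eqP; rewrite -addr_eq0 -mulr2n mulrn_eq0 => /eqP.
Qed.

(* At an even half period theta has even order of vanishing, hence it cannot
   vanish there along a smooth divisor. *)
Lemma even_half_period (u : V) : smooth_divisor theta ->
  (forall v, theta (v + (u + u)) = gauss_factor E (u + u) v * theta v) ->
  theta u <> 0.
Proof.
move=> smooth per u0; have [w /eqP] := smooth u u0; apply.
rewrite /derive_along; set L := 'D_w _ _.
have dth v : differentiable (theta : V -> R[i]^o) v by have [] := theta_hol (v := v) I.
have line (x : V) (t : R) :
    cderiv (fun s => theta (u + s%:C%C *: x)) t ('D_x (theta : V -> R[i]^o) (u + t%:C%C *: x)).
  by apply: derivable_cderiv; apply: diff_derivable.
have h1 := line w 0; have h2 := line (- w) 0.
rewrite /= !scale0r !addr0 in h1 h2.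
have dN : 'D_(- w) (theta : V -> R[i]^o) u = - L.
  by rewrite -scaleN1r derive_scale // mulN1r.
rewrite {}dN in h2.
pose c : C := (pi)%:C%C * herm E w (u + u).
have hg := cderiv_cexp (cderivM (cderiv_real 0) (cderiv_cst c 0)).
have eq s : theta (u + s%:C%C *: w) =
    cexp (s%:C%C * c) * theta (u + s%:C%C *: (- w)).
  have -> : u + s%:C%C *: w = (- u + s%:C%C *: w) + (u + u).
    by rewrite addrAC addKr.
  rewrite per gauss_factor_half; congr (_ * _).
  by rewrite -theta_sym opprD opprK scalerN.
(* The derivative of the exponential is multiplied by [theta u] = 0, so the right-hand side of [eq]
   has derivative - L, and L = - L. *)
have h3 := cderivM hg h2.
have {}h3 : cderiv (fun s => theta (u + s%:C%C *: w)) 0 (- L).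
  have -> : (fun s => theta (u + s%:C%C *: w)) =
    fun s => cexp (s%:C%C * c) * theta (u + s%:C%C *: (- w)).
    by apply/funext => s; exact: eq.
  move: h3; rewrite -[(0 : R)%:C%C]/(0 : C) scale0r addr0 u0 mulr0 add0r.
  by rewrite mul0r cexp0 mul1r.
have := cderiv_unique h1 h3 => /eqP.
by rewrite -addr_eq0 -mulr2n mulrn_eq0 => /eqP.
Qed.

End HalfPeriods.

(** * Symplectic frames of lattices *)

Section Lattices.
Variable R : realType.
Local Notation C := R[i].
Local Notation V := 'rV[R[i]^o]_2.

Definition subgrp (S : set V) := S 0 /\ forall x y, S x -> S y -> S (x - y).

Lemma subgrpN (S : set V) x : subgrp S -> S x -> S (- x).
Proof. by move=> [S0 SB] Sx; rewrite -sub0r; exact: SB. Qed.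

Lemma subgrpD (S : set V) x y : subgrp S -> S x -> S y -> S (x + y).
Proof.
by move=> hS Sx Sy; rewrite -(opprK y); apply: hS.2 => //; exact: subgrpN.
Qed.

Lemma subgrpMz (S : set V) x (n : int) : subgrp S -> S x -> S (x *~ n).
Proof.
move=> hS Sx; have H (m : nat) : S (x *+ m).
  elim: m => [|m IH]; first by rewrite mulr0n; exact: hS.1.
  by rewrite mulrS; exact: subgrpD.
by case: n => m; rewrite ?NegzE ?mulrNz -?pmulrn //; exact: subgrpN.
Qed.

Variables (Lam0 : set V) (E : V -> V -> R).
Hypothesis pol : polarization Lam0 E.

Section MinimalPairing.
Variables P Q : set V.
Hypotheses (hP : subgrp P) (hQ : subgrp Q).
Hypothesis Eint : forall x y, P x -> Q y -> exists n : int, E x y = n%:~R.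

(** [g] is the least positive value of [E]. It divides every E p y and E x q, since a nonzero
    remainder would be a smaller value. A general [x] is corrected by a multiple of [p] to x' with E
    x' q = 0; then p + x' pairs with [q] to [g] as well, and the argument applies to E (p + x')
    y. *)
Lemma minimal_pairing : (exists x y, [/\ P x, Q y & E x y <> 0]) ->
  exists p q (g : nat), [/\ P p, Q q, (0 < g)%N, E p q = g%:R &
    forall x y, P x -> Q y -> exists k : int, E x y = k%:~R * g%:R].
Proof.
move=> [x0 [y0 [Px0 Qy0 nz]]].
pose A (n : nat) := `[< (0 < n)%N /\ exists p q, [/\ P p, Q q & E p q = n%:R] >].
have exA : exists n, A n.
  have [n En] := Eint Px0 Qy0.
  have n0 : n != 0 by apply/eqP => h; apply: nz; rewrite En h.
  exists `|n|%N; apply/asboolP; split; first by rewrite absz_gt0.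
  have [n_ge|n_lt] := lerP 0 n.
    by exists x0, y0; split => //; rewrite En -[n in LHS]gez0_abs.
  exists (- x0), y0; split=> //; first exact: subgrpN.
  by rewrite (polNl pol) En -mulrNz [in RHS]pmulrn ltz0_abs.
have [g /asboolP [g0 [p [q [Pp Qq Epq]]]] gmin] := find_ex_minn exA.
have gn0 : (g%:Z != 0) by rewrite eqz_nat -lt0n.
have rem (x y : V) (m r : int) : P x -> Q y -> E x y = r%:~R ->
    r = (m %% g)%Z -> r = 0.
  move=> Px Qy Er rE; apply/eqP; apply: contraT => r0.
  have rge : 0 <= r by rewrite rE modz_ge0.
  have rlt : r < g%:Z by rewrite rE ltz_pmod.
  have /gmin : A `|r|%N.
    apply/asboolP; split; first by rewrite absz_gt0.
    by exists x, y; split => //; rewrite Er -[r in LHS]gez0_abs.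
  by rewrite -lez_nat gez0_abs // leNgt rlt.
have divr p' y : P p' -> E p' q = g%:R -> Q y -> exists k : int, E p' y = k%:~R * g%:R.
  move=> Pp' Ep' Qy; have [m Em] := Eint Pp' Qy.
  exists (m %/ g)%Z; rewrite Em {1}(divz_eq m g) rmorphD rmorphM /=.
  rewrite (rem p' (y - q *~ (m %/ g)%Z) m (m %% g)%Z) ?addr0 //.
    by apply: hQ.2 => //; exact: subgrpMz.
  rewrite (polDr pol) (polNr pol) (polMzr pol) Ep' Em {1}(divz_eq m g).
  by rewrite rmorphD rmorphM /= addrAC subrr add0r.
have divl x : P x -> exists k : int, E x q = k%:~R * g%:R.
  move=> Px; have [m Em] := Eint Px Qq.
  exists (m %/ g)%Z; rewrite Em {1}(divz_eq m g) rmorphD rmorphM /=.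
  rewrite (rem (x - p *~ (m %/ g)%Z) q m (m %% g)%Z) ?addr0 //.
    by apply: hP.2 => //; exact: subgrpMz.
  rewrite (polDl pol) (polNl pol) (polMzl pol) Epq Em {1}(divz_eq m g).
  by rewrite rmorphD rmorphM /= addrAC subrr add0r.
exists p, q, g; split=> // x y Px Qy.
have [k1 Ek1] := divl x Px; have [k2 Ek2] := divr p y Pp Epq Qy.
pose x' := x - p *~ k1.
have Px' : P x' by apply: hP.2 => //; exact: subgrpMz.
have Ex'q : E x' q = 0.
  by rewrite /x' (polDl pol) (polNl pol) (polMzl pol) Ek1 Epq subrr.
have [] := divr (p + x') y; first exact: subgrpD.
- by rewrite (polDl pol) Ex'q addr0.
- by [].
move=> k; rewrite (polDl pol) {1}/x' (polDl pol) (polNl pol) (polMzl pol) Ek2.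
move=> Ek; exists (k + (k1 * k2) - k2); rewrite !(rmorphD, rmorphN, rmorphM) /=.
by move: Ek; lra.
Qed.

End MinimalPairing.

(** The real span of [e1] and [e2] is its own orthogonal: if v = x + i y with x and y in the span,
    then E (i y, y) = E (v - x, y) = 0 forces y = 0. Pairing with [f1] and [f2] reads off the
    coordinates. *)
Lemma isotropic_coords (e1 e2 f1 f2 v : V) (g : R) : g != 0 ->
  E e1 e2 = 0 -> E v e1 = 0 -> E v e2 = 0 ->
  E e1 f1 = 1 -> E e1 f2 = 0 -> E e2 f1 = 0 -> E e2 f2 = g ->
  v = (E v f1)%:C%C *: e1 + (E v f2 / g)%:C%C *: e2.
Proof.
move=> g0 e12 ve1 ve2 e1f1 e1f2 e2f1 e2f2.
have indep (a b : R) : a%:C%C *: e1 + b%:C%C *: e2 = 0 -> a = 0 /\ b = 0.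
  move=> h; have h1 := pol0l pol f1; have h2 := pol0l pol f2.
  move: h1 h2; rewrite -h !(polDl pol) !(polZl pol) e1f1 e2f2 e1f2 e2f1.
  rewrite !mulr0 mulr1 addr0 add0r => -> /eqP; rewrite mulf_eq0 (negbTE g0) orbF.
  by move=> /eqP.
have [z [w vE]] := isotropic_span pol e12 indep v.
have S (a : R) (u : V) : a%:C%C *: ('i%C *: u) = 'i%C *: (a%:C%C *: u).
  by rewrite !scalerA mulrC.
move: vE; rewrite (complex_scale z) (complex_scale w) addrACA !S -scalerDr.
set x : V := (Re z)%:C%C *: e1 + _; set y : V := (Im z)%:C%C *: e1 + _ => vE.
have y0 : y = 0.
  apply: (pol_definite pol); rewrite (_ : 'i%C *: y = v - x).
    rewrite (polDl pol) (polNl pol) (span_isotropic pol e12) subr0.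
    by rewrite /y (polDr pol) !(polZr pol) ve1 ve2 !mulr0 addr0.
  by rewrite vE addrAC subrr add0r.
rewrite y0 scaler0 addr0 in vE.
have -> : E v f1 = Re z.
  by rewrite vE /x (polDl pol) !(polZl pol) e1f1 e2f1 mulr0 addr0 mulr1.
have -> : E v f2 / g = Re w.
  by rewrite vE /x (polDl pol) !(polZl pol) e1f2 e2f2 mulr0 add0r mulfK.
exact: vE.
Qed.

Definition zspan4 (p1 q1 p2 q2 u : V) := exists x y z w : int,
  u = p1 *~ x + q1 *~ y + p2 *~ z + q2 *~ w.

Definition pfaffian (u1 u2 u3 u4 : V) : R :=
  E u1 u2 * E u3 u4 - E u1 u3 * E u2 u4 + E u1 u4 * E u2 u3.

Definition symplectic_frame (p1 q1 p2 q2 : V) (g : R) :=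
  [/\ E p1 p2 = 0, E q1 q2 = 0, E p1 q2 = 0 & E p2 q1 = 0] /\
  (E p1 q1 = 1 /\ E p2 q2 = g).

Lemma frame_pairing (p1 q1 p2 q2 : V) (g : R) (x y z w x' y' z' w' : int) :
  symplectic_frame p1 q1 p2 q2 g ->
  E (p1 *~ x + q1 *~ y + p2 *~ z + q2 *~ w)
    (p1 *~ x' + q1 *~ y' + p2 *~ z' + q2 *~ w') =
  (x * y' - y * x')%:~R + g * (z * w' - w * z')%:~R.
Proof.
move=> [[h1 h2 h3 h4] [h5 h6]].
rewrite !(polDl pol) !(polDr pol) !(polMzl pol) !(polMzr pol).
rewrite !(pol_alternating pol) (polC pol q1 p1) (polC pol q1 p2).
rewrite (polC pol p2 p1) (polC pol q2 p1) (polC pol q2 p2) (polC pol q2 q1).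
by rewrite h1 h2 h3 h4 h5 h6 !(rmorphB, rmorphM) /=; ring.
Qed.

(** A change of vectors multiplies the Pfaffian by its determinant, and the frame itself has
    Pfaffian [g]. The witness is that determinant in its Laplace expansion by 2 x 2 minors. *)
Lemma pfaffian_dvd (p1 q1 p2 q2 u1 u2 u3 u4 : V) (g : R) :
  symplectic_frame p1 q1 p2 q2 g ->
  zspan4 p1 q1 p2 q2 u1 -> zspan4 p1 q1 p2 q2 u2 ->
  zspan4 p1 q1 p2 q2 u3 -> zspan4 p1 q1 p2 q2 u4 ->
  exists k : int, pfaffian u1 u2 u3 u4 = k%:~R * g.
Proof.
move=> fr [x1 [y1 [z1 [w1 ->]]]] [x2 [y2 [z2 [w2 ->]]]].
move=> [x3 [y3 [z3 [w3 ->]]]] [x4 [y4 [z4 [w4 ->]]]].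
rewrite /pfaffian !(frame_pairing _ _ _ _ _ _ _ _ fr).
exists ((x1 * y2 - y1 * x2) * (z3 * w4 - w3 * z4) +
        (z1 * w2 - w1 * z2) * (x3 * y4 - y3 * x4) -
        (x1 * y3 - y1 * x3) * (z2 * w4 - w2 * z4) -
        (z1 * w3 - w1 * z3) * (x2 * y4 - y2 * x4) +
        (x1 * y4 - y1 * x4) * (z2 * w3 - w2 * z3) +
        (z1 * w4 - w1 * z4) * (x2 * y3 - y2 * x3)).
by rewrite !(rmorphD, rmorphB, rmorphM) /=; ring.
Qed.

End Lattices.

(** * Frames adapted to the decomposition V1 + V2 *)

Section Frames.
Variable R : realType.
Local Notation C := R[i].
Local Notation V := 'rV[R[i]^o]_2.
Variables (Lam : set V) (E : V -> V -> R) (V1 V2 : set V).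
Hypothesis pol : polarization Lam E.
Hypothesis dec : isotropic_decomposition E V1 V2.

Lemma real_subspace_subgrp (W : set V) : real_subspace W -> subgrp W.
Proof.
move=> [W0 WZ]; split=> // x y Wx Wy.
have -> : x - y = (-1 : R)%:C%C *: y + x.
  by rewrite rmorphN rmorph1 scaleN1r addrC.
exact: WZ.
Qed.

Lemma subgrpI (S T : set V) : subgrp S -> subgrp T -> subgrp (S `&` T).
Proof.
move=> [S0 SB] [T0 TB]; split; first by [].
by move=> x y [? ?] [? ?]; split; [exact: SB|exact: TB].
Qed.

Section Frame.
Variable S : set V.
Hypothesis hS : subgrp S.
Hypothesis Sint : forall x y, (S `&` V1) x -> (S `&` V2) y ->
  exists n : int, E x y = n%:~R.

Let hS1 : subgrp (S `&` V1).
Proof. exact: subgrpI hS (real_subspace_subgrp (dec_subspace1 dec)). Qed.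

Let hS2 : subgrp (S `&` V2).
Proof. exact: subgrpI hS (real_subspace_subgrp (dec_subspace2 dec)). Qed.

Variables a1 b1 : V.
Hypotheses (Sa1 : (S `&` V1) a1) (Sb1 : (S `&` V2) b1) (Eab1 : E a1 b1 = 1).

Let P := (S `&` V1) `&` [set x | E x b1 = 0].
Let Q := (S `&` V2) `&` [set y | E a1 y = 0].

(** A minimal pairing on the orthogonal complement of [a1] and [b1] provides the second pair. Its
    value [g] divides all values of [E] there, so the real coordinates in the frame are integers. *)
Lemma complete_frame : (exists x y, [/\ P x, Q y & E x y <> 0]) ->
  exists a2 b2 (g : nat),
    [/\ (0 < g)%N, (S `&` V1) a2, (S `&` V2) b2 &
        symplectic_frame E a1 b1 a2 b2 g%:R] /\
    ((forall x, (S `&` V1) x -> exists n k : int, x = a1 *~ n + a2 *~ k) /\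
     (forall y, (S `&` V2) y -> exists n k : int, y = b1 *~ n + b2 *~ k)).
Proof.
move=> nz.
have hP : subgrp P.
  apply: subgrpI => //; split; first exact: (pol0l pol).
  by move=> x y /= hx hy; rewrite (polDl pol) (polNl pol) hx hy subrr.
have hQ : subgrp Q.
  apply: subgrpI => //; split; first exact: (pol0r pol).
  by move=> x y /= hx hy; rewrite (polDr pol) (polNr pol) hx hy subrr.
have PQint x y : P x -> Q y -> exists n : int, E x y = n%:~R.
  by move=> [Px _] [Qy _]; exact: Sint.
have [a2 [b2 [g [[Sa2 Ea2b1] [Sb2 Ea1b2] g0 Eab2 gdvd]]]] :=
  minimal_pairing pol hP hQ PQint nz.
have g0' : (g%:R : R) != 0 by rewrite pnatr_eq0 -lt0n.
have iso1 := dec_isotropic1 dec; have iso2 := dec_isotropic2 dec.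
exists a2, b2, g; split; last split.
- split=> //; split; last by [].
  by split=> //; [exact: iso1 Sa1.2 Sa2.2|exact: iso2 Sb1.2 Sb2.2].
- move=> x Sx; have [n En] := Sint Sx Sb1.
  have Px' : P (x - a1 *~ n).
    split; first by apply: hS1.2 => //; exact: subgrpMz.
    by rewrite /= (polDl pol) (polNl pol) (polMzl pol) En Eab1 mulr1 subrr.
  have Qb2 : Q b2 by split.
  have [k Ek] := gdvd _ _ Px' Qb2; exists n, k.
  have Ex2 : E x b2 = k%:~R * g%:R.
    by rewrite -Ek (polDl pol) (polNl pol) (polMzl pol) Ea1b2 mulr0 subr0.
  rewrite {1}(@isotropic_coords _ _ _ pol a1 a2 b1 b2 x g%:R) //.
  + by rewrite En Ex2 mulfK // !rmorph_int !scaler_int.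
  + exact: iso1 Sa1.2 Sa2.2.
  + exact: iso1 Sx.2 Sa1.2.
  + exact: iso1 Sx.2 Sa2.2.
- move=> y Sy; have [n En] := Sint Sa1 Sy.
  have Qy' : Q (y - b1 *~ n).
    split; first by apply: hS2.2 => //; exact: subgrpMz.
    by rewrite /= (polDr pol) (polNr pol) (polMzr pol) En Eab1 mulr1 subrr.
  have Pa2 : P a2 by split.
  have [k Ek] := gdvd _ _ Pa2 Qy'; exists n, k.
  have Ey2 : E a2 y = k%:~R * g%:R.
    by rewrite -Ek (polDr pol) (polNr pol) (polMzr pol) Ea2b1 mulr0 subr0.
  (* The vectors of V2 now stand on the left of [E]; negating [a1] and [a2] restores the signs. *)
  rewrite {1}(@isotropic_coords _ _ _ pol b1 b2 (- a1) (- a2) y g%:R) //.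
  + rewrite !(polNr pol) (polC pol y a1) (polC pol y a2) !opprK En Ey2 mulfK //.
    by rewrite !rmorph_int !scaler_int.
  + exact: iso2 Sb1.2 Sb2.2.
  + exact: iso2 Sy.2 Sb1.2.
  + exact: iso2 Sy.2 Sb2.2.
  + by rewrite (polNr pol) (polC pol b1) opprK.
  + by rewrite (polNr pol) (polC pol b1) opprK.
  + by rewrite (polNr pol) (polC pol b2) opprK.
  + by rewrite (polNr pol) (polC pol b2) opprK.
Qed.

End Frame.

Lemma subspace_pairing (p q r s : V) : V1 p -> V2 q -> V1 r -> V2 s ->
  E (p + q) (r + s) = E p s - E r q.
Proof.
move=> hp hq hr hs; rewrite (polDl pol) !(polDr pol).
rewrite (dec_isotropic1 dec hp hr) (dec_isotropic2 dec hq hs) (polC pol q r).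
by rewrite add0r addr0.
Qed.

(** The symplectic basis l, m given by the type need not respect V1 + V2 and serves only
    numerically. E (l_0, m_0) = 1 is a difference of two values of [E] on the two halves of Lam, so
    the minimal value is 1; the Pfaffian [d] is nonzero, so a second pair exists; comparing
    Pfaffians in both directions identifies its value with [d]. *)
Lemma lattice_frame (d : nat) : (0 < d)%N -> subgrp Lam ->
  polarization_type Lam E 1 d -> decomposes V1 V2 Lam ->
  exists a1 b1 a2 b2,
    [/\ (Lam `&` V1) a1, (Lam `&` V2) b1, (Lam `&` V1) a2 & (Lam `&` V2) b2] /\
    [/\ symplectic_frame E a1 b1 a2 b2 d%:R,
     (forall x, (Lam `&` V1) x -> exists n k : int, x = a1 *~ n + a2 *~ k) &
     (forall y, (Lam `&` V2) y -> exists n k : int, y = b1 *~ n + b2 *~ k)].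
Proof.
move=> d0 hL [l [m [LE ll mm lm]]] decL.
have hL1 : subgrp (Lam `&` V1).
  exact: subgrpI hL (real_subspace_subgrp (dec_subspace1 dec)).
have hL2 : subgrp (Lam `&` V2).
  exact: subgrpI hL (real_subspace_subgrp (dec_subspace2 dec)).
have Lint x y : (Lam `&` V1) x -> (Lam `&` V2) y -> exists n : int, E x y = n%:~R.
  by move=> [Lx _] [Ly _]; have /intrP := pol_integral pol Lx Ly.
have pf p1 q1 p2 q2 (h : R) : symplectic_frame E p1 q1 p2 q2 h ->
    pfaffian E p1 q1 p2 q2 = h.
  move=> [[h1 h2 h3 h4] [h5 h6]]; rewrite /pfaffian h1 h2 h3 h5 h6.
  by rewrite (polC pol q1) h4; ring.
have frlm : symplectic_frame E (l 0) (m 0) (l 1) (m 1) d%:R.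
  by split; split; rewrite ?ll ?mm ?lm.
have spanlm x : Lam x <-> zspan4 (l 0) (m 0) (l 1) (m 1) x.
  rewrite LE; split=> [[n [k ->]]|[x1 [y1 [x2 [y2 ->]]]]].
    exists (n 0), (k 0), (n 1), (k 1).
    rewrite !big_ord_recl big_ord0 addr0 !addrA /=.
    by have -> : lift ord0 ord0 = 1 :> 'I_2 by apply: val_inj.
  exists (fun i => if i == 0 then x1 else x2), (fun i => if i == 0 then y1 else y2).
  rewrite !big_ord_recl big_ord0 addr0 !addrA /=.
  by have -> : lift ord0 ord0 = 1 :> 'I_2 by apply: val_inj.
have Ll : forall i, Lam (l i) /\ Lam (m i).
  have H i : (i = 0 \/ i = 1 :> 'I_2).
    by case: i => [[|[|]]] // ii; [left|right]; apply: val_inj.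
  move=> i; case: (H i) => ->; split; apply/spanlm.
  - by exists 1, 0, 0, 0; rewrite !mulr0z !addr0.
  - by exists 0, 1, 0, 0; rewrite !mulr0z !addr0 add0r.
  - by exists 0, 0, 1, 0; rewrite !mulr0z !addr0 !add0r.
  - by exists 0, 0, 0, 1; rewrite !mulr0z !add0r.
have splitL x : Lam x -> exists p q, [/\ (Lam `&` V1) p, (Lam `&` V2) q & x = p + q].
  by move=> Lx; move: Lx; rewrite {1}decL => -[p hp [q hq <-]]; exists p, q.
have [p0 [q0 [hp0 hq0 l0E]]] := splitL _ (Ll 0).1.
have [r0 [s0 [hr0 hs0 m0E]]] := splitL _ (Ll 0).2.
have E1 : E p0 s0 - E r0 q0 = 1.
  rewrite -(subspace_pairing hp0.2 hq0.2 hr0.2 hs0.2) -l0E -m0E.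
  by rewrite lm eqxx.
have nz : exists x y, [/\ (Lam `&` V1) x, (Lam `&` V2) y & E x y <> 0].
  have [z|nz] := eqVneq (E p0 s0) 0.
    by exists r0, q0; split=> // z'; move: E1; rewrite z z' => /eqP; rewrite subrr eq_sym oner_eq0.
  by exists p0, s0; split=> //; apply/eqP.
have [a1 [b1 [g1 [La1 Lb1 g10 Eab1 g1dvd]]]] := minimal_pairing pol hL1 hL2 Lint nz.
have g11 : g1 = 1%N.
  have [k1 Ek1] := g1dvd _ _ hp0 hs0; have [k2 Ek2] := g1dvd _ _ hr0 hq0.
  have : (k1 - k2) * g1%:Z = 1.
    apply: (@intr_inj R); rewrite rmorphM rmorphB rmorph1 /=.
    by rewrite -[RHS]E1 Ek1 Ek2 mulrBl.
  by move=> h; have := congr1 absz h; rewrite abszM /= => /eqP; rewrite muln_eq1 => /andP[_ /eqP].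
rewrite g11 in Eab1.
have nz2 : exists x y, [/\ ((Lam `&` V1) `&` [set x | E x b1 = 0]) x,
    ((Lam `&` V2) `&` [set y | E a1 y = 0]) y & E x y <> 0].
  apply: contrapT => nex.
  (* Without a second pair [E] would be E x b1 * E a1 y on the two halves of Lam, hence of rank 2 on
     Lam, and all Pfaffians would vanish. *)
  have rk x y : (Lam `&` V1) x -> (Lam `&` V2) y -> E x y = E x b1 * E a1 y.
    move=> Lx Ly; apply: contrapT => ne; apply: nex.
    have [n En] := Lint _ _ Lx Lb1; have [k Ek] := Lint _ _ La1 Ly.
    exists (x - a1 *~ n), (y - b1 *~ k); split.
    - split; first by apply: hL1.2 => //; exact: subgrpMz.
      by rewrite /= (polDl pol) (polNl pol) (polMzl pol) En Eab1 mulr1 subrr.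
    - split; first by apply: hL2.2 => //; exact: subgrpMz.
      by rewrite /= (polDr pol) (polNr pol) (polMzr pol) Ek Eab1 mulr1 subrr.
    - rewrite (polDl pol) !(polDr pol) !(polNl pol) !(polNr pol).
      rewrite !(polMzl pol) !(polMzr pol) Eab1 En Ek => h; apply: ne.
      by rewrite En Ek; move: h; lra.
  have rk2 u v : Lam u -> Lam v ->
      E u v = E u b1 * E a1 v - E v b1 * E a1 u.
    move=> /splitL [p [q [hp hq ->]]] /splitL [r [s [hr hs ->]]].
    rewrite (subspace_pairing hp.2 hq.2 hr.2 hs.2) (rk _ _ hp hs) (rk _ _ hr hq).
    rewrite !(polDl pol) !(polDr pol) (dec_isotropic2 dec hq.2 Lb1.2).
    rewrite (dec_isotropic2 dec hs.2 Lb1.2) (dec_isotropic1 dec La1.2 hp.2).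
    by rewrite (dec_isotropic1 dec La1.2 hr.2) !addr0 !add0r.
  have : pfaffian E (l 0) (m 0) (l 1) (m 1) = 0.
    have [L0 M0] := Ll 0; have [L1 M1] := Ll 1.
    rewrite /pfaffian (rk2 _ _ L0 M0) (rk2 _ _ L1 M1) (rk2 _ _ L0 L1).
    by rewrite (rk2 _ _ M0 M1) (rk2 _ _ L0 M1) (rk2 _ _ M0 L1); ring.
  rewrite (pf _ _ _ _ _ frlm) => /eqP; rewrite pnatr_eq0 => /eqP dz.
  by rewrite dz in d0.
have [a2 [b2 [g [[g0 La2 Lb2 fr] [span1 span2]]]]] :=
  complete_frame hL Lint La1 Lb1 Eab1 nz2.
exists a1, b1, a2, b2; split=> //; split=> //.
suff -> : d = g by [].
have spanab x : Lam x -> zspan4 a1 b1 a2 b2 x.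
  move=> /splitL [p [q [/span1 [n [k ->]] /span2 [n' [k' ->]] ->]]].
  by exists n, n', k, k'; rewrite addrACA addrA.
have [L0 M0] := Ll 0; have [L1 M1] := Ll 1.
have [k1] := pfaffian_dvd pol fr (spanab _ L0) (spanab _ M0) (spanab _ L1) (spanab _ M1).
have [k2] := pfaffian_dvd pol frlm ((spanlm _).1 La1.1) ((spanlm _).1 Lb1.1)
  ((spanlm _).1 La2.1) ((spanlm _).1 Lb2.1).
rewrite (pf _ _ _ _ _ fr) (pf _ _ _ _ _ frlm) => e1 e2.
have dvd (x y : nat) (k : int) : x%:R = k%:~R * y%:R :> R -> (y %| x)%N.
  move=> e; have : x%:Z = k * y%:Z by apply: (@intr_inj R); rewrite rmorphM.
  by move=> /(congr1 absz); rewrite abszM /= => ->; exact: dvdn_mull.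
by apply/eqP; rewrite eqn_dvd (dvd _ _ _ e1) (dvd _ _ _ e2).
Qed.

End Frames.

(** * Finite groups with two generators *)

Section FiniteCounting.

Lemma finType_card_set (T : finType) (P : pred T) : ([set` P] #= `I_#|P|)%card.
Proof.
have -> : [set` P] = (fun i : 'I_#|P| => enum_val i) @` setT.
  apply/seteqP; split=> [x /= Px|x /= [i _ <-]]; last exact: enum_valP.
  by exists (enum_rank_in Px x) => //; rewrite enum_rankK_in.
apply: card_eq_trans; last by rewrite card_eq_sym; exact: card_II.
by apply: inj_card_eq => x y _ _; exact: enum_val_inj.
Qed.

Lemma injective_image_card (T : finType) (U : Type) (f : T -> U) (P : pred T) :
  {in P &, injective f} -> (f @` [set` P] #= `I_#|P|)%card.
Proof.
move=> fi; apply: card_eq_trans (finType_card_set P).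
by apply: inj_card_eq => x y; rewrite !inE; exact: fi.
Qed.

(** The 2-part of [s] divides 2^(k - 1), and its odd part, being coprime to 2^k, divides [i]. *)
Lemma dvdn_lower_pow2 (s k i : nat) : (0 < s)%N -> (0 < k)%N -> (logn 2 s < k)%N ->
  (s %| 2 ^ k * i)%N -> (s %| 2 ^ k.-1 * i)%N.
Proof.
move=> s0 k0 lk sd; rewrite -(partnC 2%N s0) Gauss_dvd ?coprime_partC //.
apply/andP; split.
  by apply: dvdn_mulr; rewrite p_part; apply: dvdn_exp2l; rewrite -ltnS prednK.
apply: dvdn_mull; rewrite -(@Gauss_dvdr _ (2 ^ k)).
  by apply: dvdn_trans sd; exact: dvdn_part.
rewrite coprime_sym; apply: coprimeXl.
by rewrite prime_coprime // -p'natE // part_pnat.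
Qed.

Variables (G : zmodType).

Lemma has_order_unique (S : {pred G}) m n : has_order S m -> has_order S n -> m = n.
Proof.
by move=> hm hn; apply/card_eq_II; apply: card_eq_trans hn; rewrite card_eq_sym.
Qed.

Lemma cyclic_order (S : {pred G}) (g : G) (N : nat) : (0 < N)%N ->
  (forall x, x \in S <-> exists n : int, x = g *~ n) ->
  (forall n : int, g *~ n = 0 <-> (N %| n)%Z) -> has_order S N.
Proof.
move=> N0 gen ord; rewrite /has_order.
have -> : [set` S] = (fun i : 'I_N => g *~ i) @` [set` predT].
  apply/seteqP; split=> [x /= /gen [n ->]|x /= [i _ <-]]; last by apply/gen; exists i.
  have Nz : N%:Z != 0 by rewrite eqz_nat -lt0n.
  have rlt : (`|(n %% N)%Z| < N)%N.
    by rewrite -ltz_nat gez0_abs ?modz_ge0 // ltz_pmod.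
  exists (Ordinal rlt) => //=; rewrite gez0_abs ?modz_ge0 //.
  apply/eqP; rewrite -subr_eq0 -mulrzBr; apply/eqP/ord.
  by rewrite -eqz_mod_dvd modz_mod.
rewrite -[X in `I_X](card_ord N); apply: injective_image_card => i j _ _ /eqP.
rewrite -subr_eq0 -mulrzBr => /eqP /ord.
have := ltn_ord i; have := ltn_ord j => hj hi.
rewrite -eqz_mod_dvd !modz_small ?ltz_nat // eqz_nat => /eqP ij.
exact: val_inj.
Qed.

Definition multiples (g : G) : {pred G} := fun x => `[< exists n : int, x = g *~ n >].

Lemma multiplesP g x : reflect (exists n : int, x = g *~ n) (x \in multiples g).
Proof. exact: asboolP. Qed.

Lemma multiples_zmod_closed g : zmod_closed (multiples g).
Proof.
split; first by apply/multiplesP; exists 0; rewrite mulr0z.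
move=> x y /multiplesP [n ->] /multiplesP [m ->]; apply/multiplesP.
by exists (n - m); rewrite mulrzBr.
Qed.

HB.instance Definition _ (g : G) :=
  GRing.isZmodClosed.Build G (multiples g) (multiples_zmod_closed g).

Section TwoGenerators.
Variables (X : zmodClosed G) (u w : G) (s t : nat).
Hypotheses (s0 : (0 < s)%N) (t0 : (0 < t)%N).
Hypothesis Xgen : forall x, x \in X <-> exists i j : int, x = u *~ i + w *~ j.
Hypothesis Xrel : forall i j : int,
  u *~ i + w *~ j = 0 <-> (s %| i)%Z /\ (t %| j)%Z.

Lemma two_generators_order : has_order X (s * t).
Proof.
rewrite /has_order.
have -> : [set` X] = (fun p : 'I_s * 'I_t => u *~ p.1 + w *~ p.2) @` [set` predT].
  apply/seteqP; split=> [x /= /Xgen [i [j ->]]|x /= [p _ <-]]; last first.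
    by apply/Xgen; exists p.1, p.2.
  have Nz (N : nat) : (0 < N)%N -> N%:Z != 0 by rewrite eqz_nat -lt0n.
  have rlt (n : int) (N : nat) : (0 < N)%N -> (`|(n %% N)%Z| < N)%N.
    by move=> N0; rewrite -ltz_nat gez0_abs ?modz_ge0 ?Nz // ltz_pmod.
  have dv (n : int) (N : nat) : (N %| (n %% N)%Z - n)%Z.
    by rewrite -eqz_mod_dvd modz_mod.
  exists (Ordinal (rlt i s s0), Ordinal (rlt j t t0)) => //=.
  rewrite !gez0_abs ?modz_ge0 ?Nz //.
  apply/eqP; rewrite -subr_eq0 opprD addrACA -!mulrzBr; apply/eqP/Xrel.
  by split; exact: dv.
have <- : #|(predT : pred ('I_s * 'I_t))| = (s * t)%N.
  by rewrite (eq_card (B := {: 'I_s * 'I_t})) // card_prod !card_ord.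
apply: injective_image_card => -[i j] [i' j'] _ _ /eqP /=.
rewrite -subr_eq0 opprD addrACA -!mulrzBr => /eqP /Xrel.
rewrite -!eqz_mod_dvd !modz_small ?ltz_nat ?ltn_ord // !eqz_nat.
by move=> [/eqP h /eqP h']; congr (_, _); exact: val_inj.
Qed.

End TwoGenerators.

(** For odd [t] the 2-part of Z/s x Z/t lies in Z/s, where it is generated by [u] times the odd part
    of [s]. *)
Lemma sylow2_cyclic_odd (X : zmodClosed G) (u w : G) (s t : nat) :
  (0 < s)%N -> (0 < t)%N ->
  (forall x, x \in X <-> exists i j : int, x = u *~ i + w *~ j) ->
  (forall i j : int, u *~ i + w *~ j = 0 <-> (s %| i)%Z /\ (t %| j)%Z) ->
  odd t -> exists S : zmodClosed G, sylow_subgroup 2 X S /\ cyclic_subgroup S.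
Proof.
move=> s0 t0 Xgen Xrel ot; pose g := u *~ (s`_2^')%N.
pose S : zmodClosed G := multiples g.
have Sgen x : x \in S <-> exists n : int, x = g *~ n.
  by split=> [/multiplesP|h]; last apply/multiplesP.
exists S; split; last by exists g.
split.
  by move=> x /Sgen [n ->]; apply/Xgen; exists ((s`_2^')%N%:Z * n), 0;
    rewrite mulr0z addr0 mulrzA.
exists (s * t)%N; first exact: two_generators_order Xgen Xrel.
have -> : logn 2 (s * t) = logn 2 s.
  by rewrite lognM // [logn 2 t]lognE dvdn2 ot /= andbF addn0.
apply: cyclic_order (Sgen) _; first by rewrite expn_gt0.
move=> n; have := Xrel ((s`_2^')%N%:Z * n) 0; rewrite mulr0z addr0 mulrzA -/g.
move=> ->; rewrite -p_part !dvdzE abszM /= -{1}(partnC 2%N s0) mulnC.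
rewrite dvdn_pmul2l ?part_gt0 // dvdn0.
by split=> [[]|].
Qed.

(** A generator of [S] would have order 2^(a + b), where a and b are the 2-adic valuations of [s]
    and [t]. As both are positive, 2^(a + b - 1) already kills it. *)
Lemma sylow2_noncyclic (X : zmodClosed G) (u w : G) (s t : nat) :
  (0 < s)%N -> (0 < t)%N ->
  (forall x, x \in X <-> exists i j : int, x = u *~ i + w *~ j) ->
  (forall i j : int, u *~ i + w *~ j = 0 <-> (s %| i)%Z /\ (t %| j)%Z) ->
  ~~ odd s -> ~~ odd t ->
  forall S : zmodClosed G, sylow_subgroup 2 X S -> ~ cyclic_subgroup S.
Proof.
move=> s0 t0 Xgen Xrel es et S [SX [n Xn Sn]] [g Sgen].
have nE : n = (s * t)%N.
  exact: has_order_unique Xn (two_generators_order s0 t0 Xgen Xrel).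
have [i [j gE]] : exists i j : int, g = u *~ i + w *~ j.
  by apply/Xgen/SX/Sgen; exists 1; rewrite mulr1z.
have gM (m : int) : g *~ m = 0 <-> (s %| i * m)%Z /\ (t %| j * m)%Z.
  by rewrite gE mulrzDl -!mulrzA; exact: Xrel.
pose A (m : nat) := (0 < m)%N && (g *~ m == 0).
have exA : exists m, A m.
  exists (s * t)%N; rewrite /A muln_gt0 s0 t0 /=; apply/eqP/gM.
  by rewrite !dvdzE !abszM /=; split; apply: dvdn_mull;
    [exact: dvdn_mulr|exact: dvdn_mull].
have [N /andP[N0 /eqP gN] Nmin] := find_ex_minn exA.
have Nz : N%:Z != 0 by rewrite eqz_nat -lt0n.
have ord (m : int) : g *~ m = 0 <-> (N %| m)%Z.
  split=> [gm|/dvdzP [q ->]]; last by rewrite mulrC mulrzA gN mul0rz.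
  have : g *~ (m %% N)%Z = 0.
    by move: gm; rewrite {1}(divz_eq m N) mulrzDr mulrC mulrzA gN mul0rz add0r.
  rewrite -(gez0_abs (modz_ge0 m Nz)) => gr.
  apply/dvdz_mod0P/eqP; rewrite -absz_eq0; apply: contraT => r0.
  have := Nmin `|(m %% N)%Z|%N; rewrite /A lt0n r0 gr eqxx => /(_ isT).
  by rewrite -lez_nat gez0_abs ?modz_ge0 // leNgt ltz_pmod.
have NE : N = (2 ^ logn 2 n)%N.
  exact: has_order_unique (cyclic_order N0 Sgen ord) Sn.
rewrite nE lognM // in NE.
have l1 (m : nat) : (0 < m)%N -> ~~ odd m -> (0 < logn 2 m)%N.
  by move=> m0 em; rewrite logn_gt0 mem_primes m0 /= dvdn2 em.
have ls := l1 s s0 es; have lt := l1 t t0 et.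
have [h1 h2] := (gM N).1 gN.
have k0 : (0 < logn 2 s + logn 2 t)%N by rewrite addn_gt0 ls.
have gN' : g *~ (2 ^ (logn 2 s + logn 2 t).-1)%N = 0.
  apply/gM; move: h1 h2; rewrite NE !dvdzE !abszM /= ![(`|_| * _)%N]mulnC.
  move=> h1 h2; split; apply: dvdn_lower_pow2 => //.
    by rewrite -{1}[logn 2 s]addn0 ltn_add2l.
  by rewrite -{1}[logn 2 t]add0n ltn_add2r.
move/ord: gN'; rewrite NE dvdzE /= dvdn_Pexp2l // leqNgt.
by rewrite -{2}(prednK k0) leqnn.
Qed.

End FiniteCounting.

(** * The lattice Lam' relative to Lam, and sections of M *)

Section QuotientFrame.
Variable R : realType.
Local Notation C := R[i].
Local Notation V := 'rV[R[i]^o]_2.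
Variables (Lam : set V) (E : V -> V -> R) (V1 V2 : set V).
Hypothesis pol : polarization Lam E.
Hypothesis dec : isotropic_decomposition E V1 V2.

Let hV1 : subgrp V1 := real_subspace_subgrp (dec_subspace1 dec).
Let hV2 : subgrp V2 := real_subspace_subgrp (dec_subspace2 dec).

Lemma decomposition_unique p q p' q' : V1 p -> V2 q -> V1 p' -> V2 q' ->
  p + q = p' + q' -> p = p' /\ q = q'.
Proof.
move=> hp hq hp' hq' h.
have e : p - p' = q' - q.
  by apply: (addIr q); rewrite subrK addrAC h addrAC subrr add0r.
have : (V1 `&` V2) (p - p') by split; [exact: hV1.2|rewrite e; exact: hV2.2].
rewrite (dec_direct dec) /= => /eqP; rewrite subr_eq0 => /eqP pp.
by split=> //; move: h; rewrite pp => /addrI.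
Qed.

Lemma chi0E p q : V1 p -> V2 q ->
  chi0 E V1 V2 (p + q) = cexp (0 +i* (pi * E p q))%C.
Proof.
move=> hp hq; rewrite /chi0.
have -> : component V1 V2 (p + q) = p.
  have [|c1 c2] := @xgetPex _ 0 [set v1 | V1 v1 /\ V2 (p + q - v1)].
    by exists p; split=> //; rewrite addrAC subrr add0r.
  by have [] := decomposition_unique c1 c2 hp hq; rewrite // addrC subrK.
have -> // : component V2 V1 (p + q) = q.
have [|c1 c2] := @xgetPex _ 0 [set v1 | V2 v1 /\ V1 (p + q - v1)].
  by exists q; split=> //; rewrite addrK.
by have [] := decomposition_unique c2 c1 hp hq; rewrite // subrK.
Qed.

Section QuotientLattice.
Variable S : set V.
Hypothesis hS : subgrp S.
Hypothesis Sint : forall x y, (S `&` V1) x -> (S `&` V2) y ->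
  exists n : int, E x y = n%:~R.
Hypothesis hL : subgrp Lam.
Hypothesis LS : Lam `<=` S.
Hypothesis decL : decomposes V1 V2 Lam.
Hypothesis decS : decomposes V1 V2 S.

(** The first pair of a frame of Lam has pairing 1 and so begins a frame of Lam' too. The second
    pair of Lam is orthogonal to it, hence of the form s e2, t f2, and d = E (s e2, t f2) = s t g.
    That g = 1 follows only from the order of X. *)
Lemma quotient_frame (d : nat) : (0 < d)%N -> polarization_type Lam E 1 d ->
  exists e1 f1 e2 f2 (s t g : nat),
    [/\ (S `&` V1) e1, (S `&` V2) f1, (S `&` V1) e2 & (S `&` V2) f2] /\
    [/\ (0 < s)%N, (0 < t)%N, (0 < g)%N & d = (s * t * g)%N] /\
    [/\ symplectic_frame E e1 f1 e2 f2 g%:R,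
        (forall v, S v <-> zspan4 e1 f1 e2 f2 v) &
        forall x y z w : int, Lam (e1 *~ x + f1 *~ y + e2 *~ z + f2 *~ w) <->
          (s %| z)%Z /\ (t %| w)%Z].
Proof.
move=> d0 typ.
have [e1 [f1 [a2 [b2 [[La1 Lb1 La2 Lb2] [frL spanL1 spanL2]]]]]] :=
  lattice_frame pol dec d0 hL typ decL.
have inS (W : set V) x : (Lam `&` W) x -> (S `&` W) x by move=> [/LS].
have [[_ _ Ea1b2 Ea2b1] [Ea1b1 Ea2b2]] := frL.
have nz : exists x y, [/\ ((S `&` V1) `&` [set x | E x f1 = 0]) x,
    ((S `&` V2) `&` [set y | E e1 y = 0]) y & E x y <> 0].
  exists a2, b2; split; try by split => //; exact: inS.
  by rewrite Ea2b2; apply/eqP; rewrite pnatr_eq0 -lt0n.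
have [e2 [f2 [g [[g0 Se2 Sf2 fr] [span1 span2]]]]] :=
  complete_frame pol dec hS Sint (inS _ _ La1) (inS _ _ Lb1) Ea1b1 nz.
have [[h1 h2 h3 h4] [h5 h6]] := fr.
have [n [s a2E]] := span1 _ (inS _ _ La2).
have n0 : n = 0.
  apply: (@intr_inj R); have := Ea2b1.
  by rewrite a2E (polDl pol) !(polMzl pol) h5 h4 mulr0 addr0 mulr1.
have [m [t b2E]] := span2 _ (inS _ _ Lb2).
have m0 : m = 0.
  apply: (@intr_inj R); have := Ea1b2.
  by rewrite b2E (polDr pol) !(polMzr pol) h5 h3 mulr0 addr0 mulr1.
rewrite n0 mulr0z add0r in a2E; rewrite m0 mulr0z add0r in b2E.
have dE : d%:Z = s * t * g%:Z.
  apply: (@intr_inj R); rewrite !rmorphM /= -[LHS]Ea2b2 a2E b2E.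
  by rewrite (polMzl pol) (polMzr pol) h6; ring.
have st0 : 0 < s * t by move: dE d0 g0; nia.
(* As s t > 0, both have the same sign; negating [e2] and [f2] together makes them positive and
   preserves E (e2, f2). *)
pose sg (x : V) := if 0 <= s then x else - x.
have sgS (W : set V) x : subgrp W -> (S `&` W) x -> (S `&` W) (sg x).
  move=> hW [Sx Wx]; rewrite /sg; case: ifP => _ //.
  by split; exact: subgrpN.
have sgM (x : V) (k : int) : (sg x) *~ k = x *~ (if 0 <= s then k else - k).
  by rewrite /sg; case: ifP => _ //; rewrite mulNrz mulrNz.
have frsg : symplectic_frame E e1 f1 (sg e2) (sg f2) g%:R.
  rewrite /sg; case: ifP => _ //; split; split; rewrite ?(polNl pol) ?(polNr pol) //.
  - by rewrite h1 oppr0.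
  - by rewrite h2 oppr0.
  - by rewrite h3 oppr0.
  - by rewrite h4 oppr0.
  - by rewrite opprK.
exists e1, f1, (sg e2), (sg f2), `|s|%N, `|t|%N, g.
split; first by split; [exact: inS|exact: inS|exact: sgS|exact: sgS].
split.
  split=> //.
  - by rewrite absz_gt0; apply: contraTneq st0 => ->; rewrite mul0r ltxx.
  - by rewrite absz_gt0; apply: contraTneq st0 => ->; rewrite mulr0 ltxx.
  - by apply/eqP; rewrite -eqz_nat dE PoszM -abszM gez0_abs // ltW.
split=> // [v|x y z w].
  split.
    rewrite {1}decS => -[p /span1 [k1 [k2 ->]] [q /span2 [k3 [k4 ->]] <-]].
    exists k1, k3, (if 0 <= s then k2 else - k2), (if 0 <= s then k4 else - k4).
    have opp2 (k : int) : (if 0 <= s then (if 0 <= s then k else - k)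
        else - (if 0 <= s then k else - k)) = k.
      by case: (0 <= s); rewrite ?opprK.
    by rewrite !sgM !opp2 addrACA addrA.
  move=> [x [y [z [w ->]]]].
  have [[Se1 _] [Sf1 _]] := (inS _ _ La1, inS _ _ Lb1).
  have [[Se2' _] [Sf2' _]] := (sgS _ _ hV1 Se2, sgS _ _ hV2 Sf2).
  apply: subgrpD => //; last exact: subgrpMz.
  apply: subgrpD => //; last exact: subgrpMz.
  by apply: subgrpD => //; exact: subgrpMz.
have dvdsg (k l : int) : (`|k|%N %| (if 0 <= s then l else - l))%Z = (k %| l)%Z.
  by rewrite !dvdzE; case: ifP => _; rewrite ?abszN absz_id.
have mem1 (x' z' : int) : (Lam `&` V1) (e1 *~ x' + e2 *~ z') <-> (s %| z')%Z.
  split=> [/spanL1 [k1 [k2]]|/dvdzP [q ->]].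
    rewrite a2E -mulrzA => /(congr1 (fun v => E v f2)).
    rewrite !(polDl pol) !(polMzl pol) h3 h6 !mulr0 !add0r => h.
    have g0' : (g%:R : R) != 0 by rewrite pnatr_eq0 -lt0n.
    by have /intr_inj -> := mulIf g0' h; exact: dvdz_mulr.
  rewrite mulrC mulrzA -a2E; have hLV := subgrpI hL hV1.
  by apply: subgrpD => //; exact: subgrpMz.
have mem2 (y' w' : int) : (Lam `&` V2) (f1 *~ y' + f2 *~ w') <-> (t %| w')%Z.
  split=> [/spanL2 [k1 [k2]]|/dvdzP [q ->]].
    rewrite b2E -mulrzA => /(congr1 (fun v => E e2 v)).
    rewrite !(polDr pol) !(polMzr pol) h4 h6 !mulr0 !add0r => h.
    have g0' : (g%:R : R) != 0 by rewrite pnatr_eq0 -lt0n.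
    by have /intr_inj -> := mulIf g0' h; exact: dvdz_mulr.
  rewrite mulrC mulrzA -b2E; have hLV := subgrpI hL hV2.
  by apply: subgrpD => //; exact: subgrpMz.
rewrite !sgM -(dvdsg s z) -(dvdsg t w).
set z' := if _ then z else _; set w' := if _ then w else _.
have absd (k l : int) : (`|k|%N %| l)%Z = (k %| l)%Z by rewrite !dvdzE absz_id.
rewrite !absd -(mem1 x) -(mem2 y).
have inV1 : V1 (e1 *~ x + e2 *~ z').
  by apply: subgrpD => //; apply: subgrpMz => //; [exact: La1.2|exact: Se2.2].
have inV2 : V2 (f1 *~ y + f2 *~ w').
  by apply: subgrpD => //; apply: subgrpMz => //; [exact: Lb1.2|exact: Sf2.2].
have -> : e1 *~ x + f1 *~ y + e2 *~ z' + f2 *~ w' =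
    (e1 *~ x + e2 *~ z') + (f1 *~ y + f2 *~ w') by rewrite -addrA addrACA.
split=> [|[[L1 _] [L2 _]]]; last exact: (subgrpD hL L1 L2).
rewrite {1}decL => -[p [Lp Vp] [q [Lq Vq] h]].
have [hp' hq'] := decomposition_unique Vp Vq inV1 inV2 h.
by rewrite -hp' -hq'.
Qed.

End QuotientLattice.

Section Sections.
Variables (S : set V) (theta : V -> C).
Hypothesis hS : subgrp S.
Hypothesis sec : section_of S (canonical_factor E (chi0 E V1 V2)) theta.

Lemma section_chi p q v : (S `&` V1) p -> (S `&` V2) q ->
  theta (v + (p + q)) =
    cexp (0 +i* (pi * E p q))%C * gauss_factor E (p + q) v * theta v.
Proof.
move=> [Sp Vp] [Sq Vq]; have [_ ->] := sec; last exact: subgrpD.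
by rewrite /canonical_factor chi0E.
Qed.

Let cexp00 : cexp (0 +i* (pi * 0))%C = 1 :> C.
Proof. by rewrite mulr0 -cexp0. Qed.

Lemma section_1 p v : (S `&` V1) p ->
  theta (v + p) = gauss_factor E p v * theta v.
Proof.
move=> Sp; have S0 : (S `&` V2) 0 by split; [exact: hS.1|exact: hV2.1].
by have := section_chi v Sp S0; rewrite addr0 (pol0r pol) cexp00 mul1r.
Qed.

Lemma section_2 q v : (S `&` V2) q ->
  theta (v + q) = gauss_factor E q v * theta v.
Proof.
move=> Sq; have S0 : (S `&` V1) 0 by split; [exact: hS.1|exact: hV1.1].
by have := section_chi v S0 Sq; rewrite add0r (pol0l pol) cexp00 mul1r.
Qed.

(* The cocycle condition, read off at a point where theta does not vanish. *)
Lemma section_integral p q : (exists v, theta v != 0) ->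
  (S `&` V1) p -> (S `&` V2) q -> exists n : int, E p q = n%:~R.
Proof.
move=> [v v0] Sp Sq; apply/intrP/cexp_2pi_eq1.
have : theta (v + p + q) = theta (v + q + p) by rewrite addrAC.
rewrite (section_2 _ Sq) !(section_1 _ Sp) (section_2 _ Sq) !mulrA.
move/(mulIf v0); rewrite /gauss_factor -!cexpD !(hermDl pol) => h.
have := congr1 (fun z => z * cexp (- ((pi)%:C%C * (herm E v p + herm E q p) +
  (pi / 2)%:C%C * herm E p p + ((pi)%:C%C * herm E v q +
  (pi / 2)%:C%C * herm E q q)))) h.
rewrite -!cexpD subrr cexp0 => <-; congr cexp.
have -> : (0 +i* (pi * 2 * E p q))%C = (pi)%:C%C * (0 +i* (2 * E p q))%C :> C.
  by apply: complex_eq; rewrite ?(cReM, cImM) /=; ring.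
by rewrite -(hermC pol); ring.
Qed.

End Sections.

End QuotientFrame.

(** * Fixed points *)

Section Parity.

Definition oddz (n : int) : bool := odd `|n|%N.

Lemma oddzE n : exists q : int, n = (oddz n : nat)%:Z + q * 2.
Proof.
rewrite /oddz; case: n => n /=.
  by exists (n./2)%:Z; rewrite -{1}(odd_double_half n) PoszD -muln2 PoszM.
exists (- ((odd n.+1 : nat)%:Z + (n.+1./2)%:Z)).
rewrite NegzE -{1}(odd_double_half n.+1) PoszD -muln2 PoszM; lia.
Qed.

Lemma oddz_unique (b : bool) (n q : int) : n = (b : nat)%:Z + q * 2 -> oddz n = b.
Proof. by have [r] := oddzE n; case: b; case: (oddz n) => /=; lia. Qed.

Lemma oddzD m n : oddz (m + n) = oddz m (+) oddz n.
Proof.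
have [q e] := oddzE m; have [r f] := oddzE n.
apply: (@oddz_unique _ _ (q + r + ((oddz m && oddz n) : nat)%:Z)).
by rewrite {1}e {1}f; case: (oddz m); case: (oddz n) => /=; lia.
Qed.

Lemma oddzM m n : oddz (m * n) = oddz m && oddz n.
Proof. by rewrite /oddz abszM oddM. Qed.

Lemma oddzN m : oddz (- m) = oddz m.
Proof. by rewrite /oddz abszN. Qed.

Lemma oddz_nat (n : nat) : oddz n%:Z = odd n.
Proof. by []. Qed.

Local Notation bool4 := (bool * bool * bool * bool)%type.

Lemma card_bool4 (P : pred bool4) : #|P| =
  (\sum_(a : bool) \sum_(b : bool) \sum_(c : bool) \sum_(e : bool)
    P (a, b, c, e))%N.
Proof.
rewrite -sum1_card big_mkcond /=.
rewrite (pair_bigA _ (fun a b => (\sum_(c : bool) \sum_(e : bool) P (a, b, c, e))%N)).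
rewrite (pair_bigA _ (fun p c => (\sum_(e : bool) P (p.1, p.2, c, e))%N)).
rewrite (pair_bigA _ (fun p e => nat_of_bool (P (p.1.1, p.1.2, p.2, e)))).
by apply: eq_bigr => -[[[a b] c] e] _ /=; rewrite -[_ \in _]/(P _); case: (P _).
Qed.

(** The parity of x y + z w for z = s c - al and w = t e - be, the four bits being (x, y, c, e). The
    arguments are the parities of s, t, al and be. *)
Definition odd_half (s t a b : bool) : pred bool4 := fun q =>
  (q.1.1.1 && q.1.1.2) (+) ((s && q.1.2 (+) a) && (t && q.2 (+) b)).

Lemma odd_half_even : #|odd_half false false true true| = 12.
Proof. by rewrite card_bool4 !big_bool. Qed.

Lemma odd_half_odd (s t a b : bool) : ~~ (s && t) -> #|odd_half s t a b| = 12 ->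
  ~~ s && ~~ t.
Proof. by rewrite card_bool4 !big_bool; case: s; case: t; case: a; case: b. Qed.

End Parity.

(** * Zeros of theta on half of Lam' *)

Section Zeros.
Variable R : realType.
Local Notation C := R[i].
Local Notation V := 'rV[R[i]^o]_2.
Variables (Lam S : set V) (E : V -> V -> R) (V1 V2 : set V) (theta : V -> C).
Hypothesis pol : polarization Lam E.
Hypothesis dec : isotropic_decomposition E V1 V2.
Hypothesis hS : subgrp S.
Hypothesis sec : section_of S (canonical_factor E (chi0 E V1 V2)) theta.
Hypothesis smooth : smooth_divisor theta.
Variables e1 f1 e2 f2 : V.
Hypotheses (Se1 : (S `&` V1) e1) (Sf1 : (S `&` V2) f1)
  (Se2 : (S `&` V1) e2) (Sf2 : (S `&` V2) f2).
Hypothesis fr : symplectic_frame E e1 f1 e2 f2 1.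

Let hV1 : subgrp V1 := real_subspace_subgrp (dec_subspace1 dec).
Let hV2 : subgrp V2 := real_subspace_subgrp (dec_subspace2 dec).

Definition lattice_point (x y z w : int) : V :=
  e1 *~ x + f1 *~ y + e2 *~ z + f2 *~ w.

Definition halve (v : V) : V := (2^-1 : R)%:C%C *: v.

Lemma halveD v : halve v + halve v = v.
Proof.
rewrite /halve -scalerDl -rmorphD /=.
by rewrite (_ : 2^-1 + 2^-1 = 1 :> R) ?realZ1 //; field.
Qed.

Lemma section_even v : theta (- v) = theta v.
Proof.
have [[e12 f12 e1f2 e2f1] [e1f1 e2f2]] := fr.
have SN (W : set V) x : subgrp W -> (S `&` W) x -> (S `&` W) (- x).
  by move=> hW [Sx Wx]; split; exact: subgrpN.
apply: (@theta_even R _ _ pol theta e1 e2 f1 f2) => // [|l].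
  by case: sec.
rewrite !inE => hl u.
have [h|h] : (S `&` V1) l \/ (S `&` V2) l.
- by case/or4P: hl => /eqP ->; [left|left|right|right].
- by have hN := SN _ _ hV1 h; split; exact: (section_1 pol dec hS sec).
- by have hN := SN _ _ hV2 h; split; exact: (section_2 pol dec hS sec).
Qed.

(** The integer n = x y + z w is [E] of the components in V1 and V2, so [chi0] takes the value
    (-1)^n. Six of the sixteen classes modulo 2 are odd, one for each Weierstrass point of H. *)
Lemma theta_half_zero x y z w :
  theta (halve (lattice_point x y z w)) = 0 <-> oddz (x * y + z * w).
Proof.
set l := lattice_point x y z w; set n := x * y + z * w.
have Sp : (S `&` V1) (e1 *~ x + e2 *~ z).
  by have h := subgrpI hS hV1; apply: subgrpD => //; exact: subgrpMz.
have Sq : (S `&` V2) (f1 *~ y + f2 *~ w).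
  by have h := subgrpI hS hV2; apply: subgrpD => //; exact: subgrpMz.
have lE : l = (e1 *~ x + e2 *~ z) + (f1 *~ y + f2 *~ w).
  by rewrite /l /lattice_point -addrA addrACA.
have Epq : E (e1 *~ x + e2 *~ z) (f1 *~ y + f2 *~ w) = n%:~R.
  have [[h1 h2 h3 h4] [h5 h6]] := fr.
  rewrite (polDl pol) !(polDr pol) !(polMzl pol) !(polMzr pol) h3 h4 h5 h6.
  by rewrite /n rmorphD !rmorphM /=; ring.
have per v : theta (v + (halve l + halve l)) =
    cexp (0 +i* (pi * n%:~R))%C * gauss_factor E (halve l + halve l) v * theta v.
  by rewrite halveD lE (section_chi dec hS sec) ?Epq.
have [q nE] := oddzE n.
have sign : cexp (0 +i* (pi * n%:~R))%C = (if oddz n then -1 else 1) :> C.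
  have -> : (0 +i* (pi * n%:~R))%C =
      (0 +i* (pi * (oddz n : nat)%:R))%C + (0 +i* (pi * 2 * q%:~R))%C :> C.
    rewrite {1}nE rmorphD rmorphM /=.
    by apply: complex_eq; rewrite ?(cReD, cImD) /=; ring.
  rewrite cexpD cexp_2pi_int mulr1; case: (oddz n) => /=.
    rewrite expR0 !mulr1 cospi sinpi.
    by apply: complex_eq; rewrite ?(cReN, cImN) /=; ring.
  by rewrite mulr0 expR0 cos0 sin0; apply: complex_eq => /=; ring.
rewrite sign in per; case: (oddz n) per => per; split=> //.
- move=> _; apply: (odd_half_period pol section_even) => v.
  by rewrite per mulN1r.
- move=> h; exfalso; move: h; apply: (even_half_period pol sec.1 section_even smooth).
  by move=> v; rewrite per mul1r.
Qed.

Lemma lattice_point_inj x y z w x' y' z' w' :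
  lattice_point x y z w = lattice_point x' y' z' w' ->
  [/\ x = x', y = y', z = z' & w = w'].
Proof.
move=> h.
have pair (a b c e : int) := congr1 (fun v => E v (lattice_point a b c e)) h.
(* Pairing with [f1], [e1], [f2], [e2] reads off the four coordinates up to sign. *)
move: (pair 0 1 0 0) (pair 1 0 0 0) (pair 0 0 0 1) (pair 0 0 1 0).
rewrite /lattice_point !(frame_pairing pol _ _ _ _ _ _ _ _ fr) !mul1r -!rmorphD.
by do 4![move=> /intr_inj ?]; split; lia.
Qed.

End Zeros.

(** * Fixed points on the covering curve *)

Section CoveringCurve.
Variable R : realType.
Local Notation C := R[i].
Local Notation V := 'rV[R[i]^o]_2.
Variables (Lam : zmodClosed V) (E : V -> V -> R) (X : zmodClosed {quot Lam}).
Variables (V1 V2 : set V) (theta : V -> C).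
Local Notation S := (preimage_lattice X).
Local Notation piA := (\pi_{quot Lam})%qT.
Hypothesis pol : polarization [set` Lam] E.
Hypothesis dec : isotropic_decomposition E V1 V2.
Hypothesis sec : section_of S (canonical_factor E (chi0 E V1 V2)) theta.

Lemma piA_eq (v v' : V) : piA v = piA v' <-> v - v' \in Lam.
Proof. by rewrite Quotient.idealrBE; split=> [->|/eqP]. Qed.

Lemma piAD (v v' : V) : piA (v + v') = piA v + piA v'.
Proof. exact: raddfD. Qed.

Lemma piAN (v : V) : piA (- v) = - piA v.
Proof. exact: raddfN. Qed.

Lemma piAMz (v : V) (n : int) : piA (v *~ n) = piA v *~ n.
Proof. exact: raddfMz. Qed.

Lemma piA0 (v : V) : piA v = 0 <-> v \in Lam.
Proof. by rewrite -[X in _ = X](raddf0 piA) piA_eq subr0. Qed.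

Lemma preimage_subgrp : subgrp S.
Proof.
split; first by rewrite /preimage_lattice /= raddf0 rpred0.
by move=> x y; rewrite /preimage_lattice /= raddfB; exact: rpredB.
Qed.

Lemma lattice_subgrp : subgrp [set` Lam].
Proof. by split; [exact: rpred0|move=> x y; exact: rpredB]. Qed.

Lemma lattice_sub_preimage : [set` Lam] `<=` S.
Proof. by move=> v /piA0 v0; rewrite /preimage_lattice /= v0 rpred0. Qed.

(** The canonical factor never vanishes, so the zeros of theta are invariant under all of Lam'. *)
Lemma covering_curveE (v : V) : covering_curve X theta (piA v) <-> theta v = 0.
Proof.
split=> [[v' z /eqP]|z]; last by exists v.
rewrite -Quotient.idealrBE -raddfB => Xv.
have Sv : S (v' - v) by [].
have := sec.2 _ v Sv; rewrite addrC subrK z => /esym/eqP.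
by rewrite !mulf_eq0 /chi0 !(negbTE (cexp_neq0 _)) => /eqP.
Qed.

Lemma translate_fixed (v xi : V) :
  - translation (piA xi) (piA v) = piA v <-> v + v + xi \in Lam.
Proof.
rewrite /translation -piAD -piAN piA_eq.
have -> : - (v + xi) - v = - (v + v + xi) by rewrite -opprD addrAC.
by rewrite rpredN.
Qed.

Variables (e1 f1 e2 f2 : V) (s t : nat).
Hypotheses (Se1 : (S `&` V1) e1) (Sf1 : (S `&` V2) f1)
  (Se2 : (S `&` V1) e2) (Sf2 : (S `&` V2) f2).
Hypotheses (s0 : (0 < s)%N) (t0 : (0 < t)%N).
Local Notation pt := (lattice_point e1 f1 e2 f2).
Hypothesis Sspan : forall v, S v <-> zspan4 e1 f1 e2 f2 v.
Hypothesis Lamspan : forall x y z w : int, pt x y z w \in Lam <->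
  (s %| z)%Z /\ (t %| w)%Z.

Let LamE v : v \in Lam -> exists x y z w : int, v = pt x y (s%:Z * z) (t%:Z * w).
Proof.
move=> Lv; have /Sspan [x [y [z [w vE]]]] := lattice_sub_preimage Lv.
move: Lv; rewrite vE => /Lamspan [/dvdzP [z' ->] /dvdzP [w' ->]].
by exists x, y, z', w'; rewrite mulrC (mulrC t%:Z).
Qed.

Lemma quotient_gen (x : {quot Lam}) :
  x \in X <-> exists i j : int, x = piA e2 *~ i + piA f2 *~ j.
Proof.
split=> [|[i [j ->]]]; last first.
  by rewrite rpredD // rpredMz //; [exact: Se2.1|exact: Sf2.1].
rewrite -[x]reprK => /Sspan [n1 [k1 [n2 [k2 ->]]]]; exists n2, k2.
rewrite -!piAMz -piAD piA_eq.
have -> : e1 *~ n1 + f1 *~ k1 + e2 *~ n2 + f2 *~ k2 - (e2 *~ n2 + f2 *~ k2) =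
    pt n1 k1 0 0.
  by rewrite /lattice_point !mulr0z !addr0 -(addrA (e1 *~ n1 + f1 *~ k1)) addrK.
by apply/Lamspan; rewrite !dvdz0.
Qed.

Lemma quotient_rel (i j : int) :
  piA e2 *~ i + piA f2 *~ j = 0 <-> (s %| i)%Z /\ (t %| j)%Z.
Proof.
rewrite -!piAMz -piAD piA0 -(Lamspan 0 0 i j) /lattice_point.
by rewrite !mulr0z !add0r.
Qed.

Hypothesis fr : symplectic_frame E e1 f1 e2 f2 1.
Hypothesis smooth : smooth_divisor theta.

Lemma lattice_pointD x y z w x' y' z' w' :
  pt x y z w + pt x' y' z' w' = pt (x + x') (y + y') (z + z') (w + w').
Proof.
rewrite /lattice_point !mulrzDr addrACA; congr (_ + _).
by rewrite addrACA; congr (_ + _); exact: addrACA.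
Qed.

Lemma lattice_pointN x y z w : - pt x y z w = pt (- x) (- y) (- z) (- w).
Proof. by rewrite /lattice_point !mulrNz !opprD. Qed.

Lemma halve_double (v : V) : halve (v + v) = v.
Proof. by rewrite /halve scalerDr; exact: halveD. Qed.

Lemma halveB (u v : V) : halve u - halve v = halve (u - v).
Proof. by rewrite /halve scalerBr. Qed.

Variables al be : int.
Local Notation xi := (e2 *~ al + f2 *~ be).

(** A fixed point v satisfies v + v + xi in Lam, so v + v runs over Lam - xi modulo 2 Lam. The bits
    represent, modulo 2, the coordinates in the basis [e1], [f1], s e2, t f2 of Lam; the value is v
    + v, before halving. *)
Definition fixed_lift (q : bool * bool * bool * bool) : V :=
  pt (q.1.1.1 : nat)%:Z (q.1.1.2 : nat)%:Z
    (s%:Z * (q.1.2 : nat)%:Z - al) (t%:Z * (q.2 : nat)%:Z - be).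

Lemma fixed_lift_inj : injective (fun q => piA (halve (fixed_lift q))).
Proof.
move=> [[[a b] c] e] [[[a' b'] c'] e'] /piA_eq.
rewrite halveB => /LamE [x [y [z [w]]]] /(congr1 (fun v => v + v)).
rewrite halveD /fixed_lift lattice_pointN !lattice_pointD /=.
move=> /(lattice_point_inj pol fr) [h1 h2 h3 h4].
have bool_eq (m m' : bool) (k : int) :
    (m : nat)%:Z - (m' : nat)%:Z = k + k -> m = m'.
  by case: m; case: m' => /=; lia.
have cancel (n : nat) (m m' : bool) (k al' : int) : (0 < n)%N ->
    n%:Z * (m : nat)%:Z - al' - (n%:Z * (m' : nat)%:Z - al') = n%:Z * k + n%:Z * k ->
    m = m'.
  move=> n0 h; apply: (bool_eq _ _ k); apply: (@mulfI _ n%:Z).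
    by rewrite eqz_nat -lt0n.
  by move: h; rewrite mulrBr mulrDr; lia.
congr (_, _, _, _); [exact: bool_eq h1|exact: bool_eq h2| |].
  exact: cancel s0 h3.
exact: cancel t0 h4.
Qed.

Lemma fixed_points_card : (fixed_points_in (covering_curve X theta)
    (fun a => - translation (piA xi) a)%R #=
  `I_#|odd_half (odd s) (odd t) (oddz al) (oddz be)|)%card.
Proof.
have theta0 q : theta (halve (fixed_lift q)) = 0 <->
    odd_half (odd s) (odd t) (oddz al) (oddz be) q.
  rewrite /fixed_lift (theta_half_zero pol dec preimage_subgrp sec smooth Se1 Sf1 Se2 Sf2 fr).
  rewrite oddzD !oddzM !oddzD !oddzM !oddzN !oddz_nat /odd_half.
  by case: q => [[[[] []] []] []].
have fixed q : halve (fixed_lift q) + halve (fixed_lift q) + xi \in Lam.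
  have -> : halve (fixed_lift q) + halve (fixed_lift q) + xi =
      pt (q.1.1.1 : nat)%:Z (q.1.1.2 : nat)%:Z
         (s%:Z * (q.1.2 : nat)%:Z) (t%:Z * (q.2 : nat)%:Z).
    have -> : xi = pt 0 0 al be by rewrite /lattice_point !mulr0z !add0r.
    by rewrite halveD /fixed_lift lattice_pointD !addr0 !subrK.
  by apply/Lamspan; split; exact: dvdz_mulr.
suff -> : fixed_points_in (covering_curve X theta)
    (fun a => - translation (piA xi) a)%R =
    (fun q => piA (halve (fixed_lift q))) @`
      [set` odd_half (odd s) (odd t) (oddz al) (oddz be)].
  by apply: injective_image_card => q q' _ _; exact: fixed_lift_inj.
apply/seteqP; split=> [a|a [q /= Pq <-]]; last first.
  by split; [apply/covering_curveE/theta0|apply/translate_fixed].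
rewrite -[a]reprK; move: (repr a) => v [/covering_curveE th0 /translate_fixed Lv].
have [x [y [z [w vE]]]] := LamE Lv.
have [qx xE] := oddzE x; have [qy yE] := oddzE y.
have [qz zE] := oddzE z; have [qw wE] := oddzE w.
(* Reducing the coordinates modulo 2 changes v + v by twice an element of Lam, hence v by an element
   of Lam. *)
pose q := (oddz x, oddz y, oddz z, oddz w).
have eq_pi : piA (halve (fixed_lift q)) = piA v.
  apply/piA_eq; rewrite -(halve_double v) halveB.
  have -> : v + v = pt x y (s%:Z * z - al) (t%:Z * w - be).
    rewrite -[LHS](addrK xi) vE.
    have -> : xi = pt 0 0 al be by rewrite /lattice_point !mulr0z !add0r.
    by rewrite lattice_pointN lattice_pointD !oppr0 !addr0.
  have -> : fixed_lift q - pt x y (s%:Z * z - al) (t%:Z * w - be) =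
      pt (- qx) (- qy) (s%:Z * - qz) (t%:Z * - qw) +
      pt (- qx) (- qy) (s%:Z * - qz) (t%:Z * - qw).
    rewrite /fixed_lift lattice_pointN !lattice_pointD /=.
    have tw (n r : int) : n = (oddz n : nat)%:Z + r * 2 ->
      (oddz n : nat)%:Z - n = - r + - r by lia.
    have tws (m : nat) (n r c : int) : n = (oddz n : nat)%:Z + r * 2 ->
        m%:Z * (oddz n : nat)%:Z - c - (m%:Z * n - c) = m%:Z * - r + m%:Z * - r.
      by move=> /tw h; rewrite -mulrDr -h mulrBr; ring.
    by rewrite (tw _ _ xE) (tw _ _ yE) (tws _ _ _ _ zE) (tws _ _ _ _ wE).
  by rewrite halve_double; apply/Lamspan; split; exact: dvdz_mulr.
exists q => //=; apply/theta0/covering_curveE.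
by rewrite eq_pi; apply/covering_curveE.
Qed.

End CoveringCurve.

Theorem theorem0p4 (R : realType) (d : nat)
  (Lam : zmodClosed 'rV[R[i]^o]_2) (E : 'rV[R[i]^o]_2 -> 'rV[R[i]^o]_2 -> R)
  (X : zmodClosed {quot Lam})
  (V1 V2 : set 'rV[R[i]^o]_2) (theta : 'rV[R[i]^o]_2 -> R[i]) :
  (0 < d)%N -> ~~ odd d ->
  (* A = V/Lam, with a polarization of type (1, d) *)
  lattice [set` Lam] ->
  polarization [set` Lam] E ->
  polarization_type [set` Lam] E 1 d ->
  (* the decomposition V = V1 + V2, compatible with Lam and Lam' *)
  isotropic_decomposition E V1 V2 ->
  decomposes V1 V2 [set` Lam] ->
  decomposes V1 V2 (preimage_lattice X) ->
  (* X <= K(L) has order d *)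
  [set` X] `<=` K_of Lam (canonical_factor E (chi0 E V1 V2)) ->
  has_order X d ->
  (* H = div(theta), for a nonzero section theta of M on A/X = V/Lam', is a
     smooth curve of genus 2 *)
  section_of (preimage_lattice X) (canonical_factor E (chi0 E V1 V2)) theta ->
  (exists v, theta v != 0) ->
  smooth_curve_of_genus (preimage_lattice X) theta 2 ->
  (exists2 x : {quot Lam}, x \in X &
     (fixed_points_in (covering_curve X theta)
        (fun a => - translation x a)%R #= `I_12)%card) <->
  (forall S : zmodClosed {quot Lam}, sylow_subgroup 2 X S ->
     ~ cyclic_subgroup S).
Proof.
move=> d0 ed _ pol typ dec decL decS _ Xd sec nz [smooth _ _].
have hS := preimage_subgrp X.
have Sint x y : (preimage_lattice X `&` V1) x -> (preimage_lattice X `&` V2) y ->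
    exists n : int, E x y = n%:~R.
  exact: (section_integral pol dec hS sec nz).
have [e1 [f1 [e2 [f2 [s [t [g [[Se1 Sf1 Se2 Sf2] [[s0 t0 g0 dE]
    [fr Sspan Lamspan]]]]]]]]]] :=
  quotient_frame pol dec hS Sint (lattice_subgrp Lam)
    (@lattice_sub_preimage _ Lam X) decL decS d0 typ.
have Xgen := quotient_gen Se2 Sf2 Sspan Lamspan.
have Xrel := quotient_rel Lamspan.
have dst : d = (s * t)%N.
  exact: has_order_unique Xd (two_generators_order s0 t0 Xgen Xrel).
(* Comparing d = s t g with the order s t of X shows that [E] is principal on Lam'. *)
have g1 : g = 1%N.
  by apply/eqP; rewrite -(eqn_pmul2l d0) muln1 {2}dE -dst.
rewrite g1 in fr; have st : ~~ (odd s && odd t) by rewrite -oddM -dst.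
have count al be := fixed_points_card pol dec sec Se1 Sf1 Se2 Sf2 s0 t0 Sspan
  Lamspan fr smooth al be.
split=> [[x /Xgen [al [be ->]]]|noncyc].
  rewrite -!piAMz -piAD => x12.
  have c12 : #|odd_half (odd s) (odd t) (oddz al) (oddz be)| = 12.
    apply/card_eq_II; apply: card_eq_trans x12; rewrite card_eq_sym.
    exact: count.
  have /andP[os ot] := odd_half_odd st c12.
  exact: sylow2_noncyclic s0 t0 Xgen Xrel os ot.
(* An odd [t] would put the Sylow 2-subgroup into the cyclic factor generated by the class of [e2];
   an odd [s] is treated by exchanging the two factors. *)
have ot : ~~ odd t.
  apply/negP => ot; have [S [syl cyc]] := sylow2_cyclic_odd s0 t0 Xgen Xrel ot.
  exact: noncyc syl cyc.
have os : ~~ odd s.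
  apply/negP => os.
  have Xgen' x : x \in X <-> exists i j : int,
      x = (\pi_{quot Lam} f2)%qT *~ i + (\pi_{quot Lam} e2)%qT *~ j.
    by rewrite Xgen; split=> -[i [j ->]]; exists j, i; exact: addrC.
  have Xrel' (i j : int) :
      (\pi_{quot Lam} f2)%qT *~ i + (\pi_{quot Lam} e2)%qT *~ j = 0 <->
      (t %| i)%Z /\ (s %| j)%Z.
    by rewrite addrC Xrel and_comm.
  have [S [syl cyc]] := sylow2_cyclic_odd t0 s0 Xgen' Xrel' os.
  exact: noncyc syl cyc.
(* With both coefficients odd and s, t even, x y + z w is odd exactly when x y is even. *)
exists (\pi_{quot Lam} (e2 *~ 1 + f2 *~ 1))%qT.
  by rewrite piAD !piAMz; apply/Xgen; exists 1, 1.
have := count 1 1; rewrite (negbTE os) (negbTE ot).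
by have -> : oddz 1 = true by []; rewrite odd_half_even.
Qed.
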